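(* The number of sets $A\subseteq[n]$ satisfying $2n\notin\sum A$ is $2^{(\frac13+o(1))\cdot n}$ (as $n\to\infty$).
   Context: $[n]=\{1,\ldots,n\}$. For $k\ge 0$, $kA=\{a_1+\cdots+a_k\mid a_1,\ldots,a_k\in A\}$ (repetitions allowed, $0A=\{0\}$), and $\sum A=\bigcup_{k\ge0}kA$. The sets $A$ are not assumed to be sum-free. *)

(* Defs.v *)
From mathcomp Require Import all_boot all_order all_algebra.
From mathcomp Require Import all_classical all_reals all_analysis.

Set Implicit Arguments.
Unset Strict Implicit.
Unset Printing Implicit Defensive.

Local Open Scope classical_set_scope.
Local Open Scope nat_scope.

Definition ksum (k : nat) (A : set nat) : set nat :=
  [set m | exists2 a : 'I_k -> nat, (forall i, A (a i)) & m = \sum_(i < k) a i].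

Definition allsums (A : set nat) : set nat := \bigcup_k ksum k A.

(* Subsets of [n] = {1, ..., n} are encoded as the finite sets of ordinals
   i < n.+1 that do not contain 0, so that each element is its own value. *)
Definition to_nats (n : nat) (A : {set 'I_n.+1}) : set nat :=
  [set nat_of_ord i | i in [set` A]].

Definition avoiding (n : nat) : {set {set 'I_n.+1}} :=
  [set A : {set 'I_n.+1} |
    (ord0 \notin A) && `[< ~ allsums (to_nats A) (2 * n) >]]%SET.

(* Main.v *)
Require Import Defs.
From mathcomp Require Import all_boot all_order all_algebra all_fingroup cyclic.
From mathcomp Require Import boolp zify.

Set Implicit Arguments.
Unset Strict Implicit.
Unset Printing Implicit Defensive.

(* The lower bound comes from the subsets of (2n/3, n).  For the upper bound, every avoiding
   set A is covered by a container determined by a small T, namely the w least elements of A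
   together with a subset of A chosen so that adding any further a in A increases the set
   S = <T> of sums up to 2n by at most s elements.  Then a + S is almost contained in S for
   all a in the container, hence also for all sums of such a, and averaging over the least
   elements t shows that deleting few elements of the container leaves a set D with
   2n - t outside the semigroup generated by D and t, where t <= min D.

   It remains to see that a numerical semigroup G with least positive element t and
   2n - t outside G has at most n/3 + o(n) elements up to n.  Modulo t, the elements of G
   below x form a set R(x) with R(x) + R(y) inside R(x + y), and four-fold sums reaching
   at most 2n avoid 2n.  Kneser's theorem then gives |R(x)| + |R(y)| <= 2t/3 for
   x + y <= n, and [1, n] is tiled by windows of length t that are paired in this way; the
   leftover window, shorter than t, is controlled by the same structure modulo a divisor of t. *)

(** * Kneser's theorem *)

(** From [(a - l) * (b - l) >= 0] comes [l * (a + b - l) <= a * b], so the two strict bounds force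
    both [p + q < h1] and [h1 < p + q]. *)
Lemma grid_arith (l h1 h2 p q : nat) : l <= p -> l <= q -> l <= h2 - p -> l <= h1 - q ->
  p * q < l * (h1 - l) -> (h2 - p) * (h1 - q) < l * (h2 - l) -> False.
Proof.
move=> lp lq lp' lq' E1 E2.
have F a b : l <= a -> l <= b -> l * (a + b - l) <= a * b.
  move=> /subnK <- /subnK <-; set a' := a - l; set b' := b - l; nia.
have := leq_ltn_trans (F _ _ lp lq) E1; have := leq_ltn_trans (F _ _ lp' lq') E2.
case: (posnP l) => [->|l0]; first by rewrite !mul0n.
rewrite !ltn_pmul2l //; lia.
Qed.

Section Kneser.
Local Open Scope group_scope.
Variable gT : finGroupType.
Hypothesis abT : abelian [set: gT].
Implicit Types (A B C X : {set gT}) (x y : gT).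

Let mC x y : x * y = y * x.
Proof. by apply: (centsP abT); rewrite inE. Qed.

Let smC A B : A * B = B * A.
Proof. by apply/setP=> z; apply/mulsgP/mulsgP=> -[a b Ha Hb ->]; exists b a; rewrite // mC. Qed.

(** The stabiliser of [C], the subgroup of Kneser's theorem; locked so that [inE] does not unfold
    it. *)
Definition period C : {set gT} := locked [set x | C :* x == C].

Lemma in_period C x : (x \in period C) = (C :* x == C).
Proof. by rewrite /period -lock inE. Qed.

Lemma period_group_set C : group_set (period C).
Proof.
apply/group_setP; split=> [|x y]; first by rewrite in_period mulg1.
by rewrite !in_period => /eqP Hx /eqP Hy; rewrite rcosetM Hx Hy.
Qed.
Canonical period_group C := Group (period_group_set C).

Lemma mem_period C x c : x \in period C -> (c * x \in C) = (c \in C).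
Proof. by rewrite in_period => /eqP {1}<-; rewrite mem_rcoset mulgK. Qed.

Lemma periodP C x : reflect (forall c, c \in C -> c * x \in C) (x \in period C).
Proof.
apply: (iffP idP) => [Hx c|H]; first by rewrite (mem_period c Hx).
by rewrite in_period eqEcard card_rcoset leqnn andbT; apply/subsetP=> z /rcosetP [c /H Hc ->].
Qed.

Lemma mul_period C : C * period C = C.
Proof.
apply/setP=> z; apply/mulsgP/idP=> [[c x Hc Hx ->]|Hz].
  by rewrite (mem_period _ Hx).
by exists z 1; rewrite ?mulg1 // group1.
Qed.

(** Two pairs with the same product differ by an element of [H1 :&: H2], so each fibre of the
    product map embeds there. *)
Lemma card_grid (H1 H2 : {group gT}) (V U : {set gT}) (c : gT) :
  V \subset H1 -> U \subset H2 ->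
  #|V| * #|U| <= #|[set c * (h.1 * h.2) | h in setX V U]| * #|H1 :&: H2|.
Proof.
move=> sV sU.
set f := fun h : gT * gT => c * (h.1 * h.2).
rewrite -cardsX -sum1_card (partition_big_imset f) /= -sum_nat_const.
apply: leq_sum => z /imsetP [[v u]]; rewrite !inE /= => /andP [Hv Hu] Hz.
rewrite sum1dep_card.
set P := [set _ | _].
have inj : {in P &, injective (fun h : gT * gT => v^-1 * h.1)}.
  move=> [a b] [a' b']; rewrite !inE /= => /andP [_ /eqP E1] /andP [_ /eqP E2] /mulgI E.
  by move: E1; rewrite -E2 /f /= => /mulgI; rewrite E => /mulgI ->.
rewrite -(card_in_imset inj); apply: subset_leq_card; apply/subsetP=> w /imsetP [[a b]].
rewrite !inE /= => /andP [/andP [Ha Hb] /eqP E] ->.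
have E' : v * u = a * b by move: E; rewrite Hz /f /= => /mulgI.
rewrite groupM ?groupV ?(subsetP sV) //=.
have -> : v^-1 * a = u * b^-1 by apply: (mulgI v); rewrite !mulgA E' mulgV mul1g mulgK.
by rewrite groupM ?groupV ?(subsetP sU).
Qed.

(* If neither set contains the other, look at a coset [c * H1 * H2] as a grid whose rows and
   columns are cosets of the two periods: there [C1] is a union of rows and [C2] of columns,
   so one of the two differences has at least [#|Hi| - #|H1 :&: H2|] elements. *)
Lemma period_union C1 C2 :
  minn (#|C1| + #|period C1|) (#|C2| + #|period C2|)
    <= #|C1 :|: C2| + #|period (C1 :|: C2)|.
Proof.
set H1 := [group of period C1]; set H2 := [group of period C2].
have sL : H1 :&: H2 \subset period (C1 :|: C2).
  apply/subsetP=> x; rewrite inE => /andP [x1 x2]; apply/periodP=> c.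
  by rewrite !inE (mem_period _ x1) (mem_period _ x2).
have [/eqP s21|n21] := boolP (C2 :\: C1 == set0).
  have -> : C1 :|: C2 = C1 by apply/setUidPl; rewrite -setD_eq0 s21.
  exact: geq_minl.
have [/eqP s12|n12] := boolP (C1 :\: C2 == set0).
  have -> : C1 :|: C2 = C2 by apply/setUidPr; rewrite -setD_eq0 s12.
  exact: geq_minr.
have cU : #|C1 :|: C2| = #|C1| + #|C2 :\: C1|.
  by rewrite cardsU cardsD (setIC C2); have := subset_leq_card (subsetIr C1 C2); lia.
have cU' : #|C1 :|: C2| = #|C2| + #|C1 :\: C2|.
  by rewrite cardsU cardsD; have := subset_leq_card (subsetIl C1 C2); lia.
have arith c1 h u z p i : u = c1 + z -> h - i <= z -> i <= p -> (c1 + h <= u + p)%N by lia.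
suff : #|H1| - #|H1 :&: H2| <= #|C2 :\: C1| \/ #|H2| - #|H1 :&: H2| <= #|C1 :\: C2|.
  rewrite geq_min => -[le|le]; apply/orP; [left|right].
    exact: arith cU le (subset_leq_card sL).
  exact: arith cU' le (subset_leq_card sL).
set l := #|H1 :&: H2|.
have l_gt0 : 0 < l by exact: cardG_gt0.
(* In the grid through [c], [V c] selects the cosets of [H2] lying in [C2], and [U c] the cosets of
   [H1] lying in [C1]. *)
pose V c := [set h in H1 | c * h \in C2]; pose U c := [set h in H2 | c * h \in C1].
have grid c : #|V c| * (#|H2| - #|U c|) <= #|C2 :\: C1| * l
           /\ (#|H1| - #|V c|) * #|U c| <= #|C1 :\: C2| * l.
  have sV : V c \subset H1 by apply/subsetP=> x; rewrite inE => /andP [].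
  have sU : U c \subset H2 by apply/subsetP=> x; rewrite inE => /andP [].
  have cD (A B : {set gT}) : A \subset B -> #|B :\: A| = #|B| - #|A|.
    by move=> sAB; rewrite cardsD (setIidPr sAB).
  split; [rewrite -(cD _ _ sU)|rewrite -(cD _ _ sV)].
    apply: leq_trans (card_grid c sV (subsetDl H2 (U c))) _.
    rewrite leq_mul2r subset_leq_card ?orbT //.
    apply/subsetP=> z /imsetP [[a b]]; rewrite !inE /=.
    move=> /andP [/andP [a1 aC] /andP [bU b2]] ->; rewrite b2 /= in bU.
    by rewrite {1}(mC a) !mulgA (mem_period _ b2) (mem_period _ a1) aC bU.
  apply: leq_trans (card_grid c (subsetDl H1 (V c)) sU) _.
  rewrite leq_mul2r subset_leq_card ?orbT //.
  apply/subsetP=> z /imsetP [[a b]]; rewrite !inE /=.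
  move=> /andP [/andP [aV a1] /andP [b2 bC]] ->; rewrite a1 /= in aV.
  by rewrite {2}(mC a) !mulgA (mem_period _ b2) (mem_period _ a1) bC aV.
(* [V c], [U c] and their complements are unions of cosets of [H1 :&: H2], so each is empty or has
   at least [l] elements. *)
have Lsub c x (S : {set gT}) (H : {group gT}) (C : {set gT}) :
    {subset H1 :&: H2 <= period C} -> S = [set h in H | c * h \in C] ->
    {subset H1 :&: H2 <= H} -> x \in S -> l <= #|S|.
  move=> LC -> LH; rewrite inE => /andP [xH xC]; rewrite -[l](card_lcoset _ x).
  apply: subset_leq_card; apply/subsetP=> y /lcosetP [h hL ->].
  by rewrite inE mulgA (mem_period _ (LC _ hL)) xC andbT groupM // LH.
have L1 : {subset H1 :&: H2 <= H1} by move=> x; rewrite inE => /andP [].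
have L2 : {subset H1 :&: H2 <= H2} by move=> x; rewrite inE => /andP [].
have lV c x : x \in V c -> l <= #|V c| by exact: (@Lsub c x (V c) H1 C2 L2 erefl L1).
have lU c x : x \in U c -> l <= #|U c| by exact: (@Lsub c x (U c) H2 C1 L1 erefl L2).
have LN (C : {set gT}) : {subset H1 :&: H2 <= period C} -> {subset H1 :&: H2 <= period (~: C)}.
  move=> LC x xL; apply/periodP=> c; rewrite !inE; apply: contra.
  by rewrite (mem_period _ (LC _ xL)).
have lV' c x : x \in H1 -> x \notin V c -> l <= #|H1| - #|V c|.
  move=> xH xV; have -> : #|H1| - #|V c| = #|[set h in H1 | c * h \in ~: C2]|.
    rewrite -(cardsID (V c) H1) (setIidPr _) ?addKn; last by apply/subsetP=> y; rewrite inE => /andP [].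
    by congr #|pred_of_set _|; apply/setP=> y; rewrite !inE; case: (y \in H1) => //; rewrite andbT.
  apply: (@Lsub c x _ H1 (~: C2)) => //; first exact: LN.
  by rewrite !inE xH; move: xV; rewrite inE xH.
have lU' c x : x \in H2 -> x \notin U c -> l <= #|H2| - #|U c|.
  move=> xH xU; have -> : #|H2| - #|U c| = #|[set h in H2 | c * h \in ~: C1]|.
    rewrite -(cardsID (U c) H2) (setIidPr _) ?addKn; last by apply/subsetP=> y; rewrite inE => /andP [].
    by congr #|pred_of_set _|; apply/setP=> y; rewrite !inE; case: (y \in H2) => //; rewrite andbT.
  apply: (@Lsub c x _ H2 (~: C1)) => //; first exact: LN.
  by rewrite !inE xH; move: xU; rewrite inE xH.
have dU' c : #|H2| - #|U c| = 0 \/ l <= #|H2| - #|U c|.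
  have [/subsetP s|/subsetPn [x xH xU]] := boolP (H2 \subset U c); last by right; apply: lU' xH xU.
  by left; apply/eqP; rewrite subn_eq0 subset_leq_card //; apply/subsetP.
have dV' c : #|H1| - #|V c| = 0 \/ l <= #|H1| - #|V c|.
  have [/subsetP s|/subsetPn [x xH xV]] := boolP (H1 \subset V c); last by right; apply: lV' xH xV.
  by left; apply/eqP; rewrite subn_eq0 subset_leq_card //; apply/subsetP.
have dU c : #|U c| = 0 \/ l <= #|U c|.
  by have [->|[x /lU]] := set_0Vmem (U c); [left; rewrite cards0|right].
have dV c : #|V c| = 0 \/ l <= #|V c|.
  by have [->|[x /lV]] := set_0Vmem (V c); [left; rewrite cards0|right].
have [c cD] := set0Pn _ n21; have [d dD] := set0Pn _ n12.
have [vc uc] : 1 \in V c /\ 1 \notin U c.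
  by move: cD; rewrite !inE !group1 !mulg1 => /andP [].
have [vd ud] : 1 \notin V d /\ 1 \in U d.
  by move: dD; rewrite !inE !group1 !mulg1 => /andP [].
have := lV _ _ vc; have := lU' _ _ (group1 _) uc.
have := lU _ _ ud; have := lV' _ _ (group1 _) vd.
have := (dU c, dV' c, dU' d, dV d).
have [] := grid c; have [] := grid d; rewrite -/l.
move: (leq_subr #|U c| #|H2|) (leq_subr #|V c| #|H1|).
have : #|V c| <= #|H1| by apply: subset_leq_card; apply/subsetP=> x; rewrite inE => /andP [].
have : #|U c| <= #|H2| by apply: subset_leq_card; apply/subsetP=> x; rewrite inE => /andP [].
have : #|V d| <= #|H1| by apply: subset_leq_card; apply/subsetP=> x; rewrite inE => /andP [].
have : #|U d| <= #|H2| by apply: subset_leq_card; apply/subsetP=> x; rewrite inE => /andP [].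
have : l <= #|H1| by exact: (subset_leq_card (subsetIl H1 H2)).
have : l <= #|H2| by exact: (subset_leq_card (subsetIr H1 H2)).
clear -l_gt0.
move: l #|V c| #|U c| #|V d| #|U d| #|H1| #|H2| #|_ :\: _| #|_ :\: _| l_gt0.
move=> l vc uc vd ud h1 h2 x12 x21 l_gt0 lh2 lh1 ud2 vd1 uc2 vc1 _ _ gd1 gd2 gc1 gc2.
move=> [[[duc dvc] dud] dvd] lud' lvd' luc' lvc'.
have [_|n1] := leqP (h1 - l) x21; first by left.
have [_|n2] := leqP (h2 - l) x12; first by right.
exfalso.
rewrite -(ltn_pmul2l l_gt0) mulnC in n1; rewrite -(ltn_pmul2l l_gt0) mulnC in n2.
(* [grid_arith] refutes the grid through [c] unless [uc = 0] or [vc = h1], and the one through [d]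
   unless [vd = 0] or [ud = h2]; comparing products directly settles these cases. *)
case: duc => [u0|luc].
  case: dvd => [v0|lvd].
    move: gc1 gd2; rewrite u0 v0 !subn0 => gc1 gd2; nia.
  case: dud => [u1|lud]; first by nia.
  apply: (@grid_arith l h1 h2 (h2 - ud) vd lud lvd).
  - by rewrite subKn.
  - exact: lud'.
  - by rewrite mulnC (leq_ltn_trans gd1).
  - by rewrite subKn // mulnC (leq_ltn_trans gd2).
case: dvc => [v1|lvc]; first by nia.
apply: (@grid_arith l h1 h2 (h2 - uc) vc luc' lvc').
- by rewrite subKn.
- exact: lvc.
- by rewrite mulnC (leq_ltn_trans gc1).
- by rewrite subKn // mulnC (leq_ltn_trans gc2).
Qed.

(** A largest admissible subset of [C] is all of [C]: its union with a set covering a missed point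
    would be larger and, by [period_union], still admissible. *)
Lemma period_cover C k : C != set0 ->
  (forall c, c \in C -> exists X, [/\ c \in X, X \subset C & k <= #|X| + #|period X|]) ->
  k <= #|C| + #|period C|.
Proof.
move=> /set0Pn [c0 c0C] H.
pose P X := (X \subset C) && (k <= #|X| + #|period X|).
have [X0 [_ X0C X0k]] := H _ c0C.
have PX0 : P X0 by rewrite /P X0C.
case: (arg_maxnP (fun X => #|X|) PX0) => X /andP [XC Xk] maxX.
have [/eqP <- //|nXC] := boolP (X == C).
have /subsetPn [c cC cX] : ~~ (C \subset X) by move: nXC; rewrite eqEsubset XC.
have [Y [cY YC Yk]] := H _ cC.
have PXY : P (X :|: Y).
  rewrite /P subUset XC YC /=; apply: leq_trans (period_union X Y).
  by rewrite leq_min Xk Yk.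
suff /proper_card : X \proper X :|: Y by rewrite ltnNge; have /= -> := maxX _ PXY.
rewrite properE subsetUl /=.
by apply/subsetPn; exists c; rewrite // inE cY orbT.
Qed.

(* Dyson's e-transform, iterated until [A * B = A]; then [B] lies in the period of [A]. *)
Lemma dyson_cover A B a : a \in A -> 1 \in B ->
  exists X, [/\ a \in X, X \subset A * B & #|A| + #|B| <= #|X| + #|period X|].
Proof.
have [m] := ubnP #|B|; elim: m => // m IH in A B *; rewrite ltnS => Bm aA B1.
have [/existsP [e /andP [eA nB]]|/existsPn nE] := boolP [exists e in A, ~~ (B \subset e^-1 *: A)].
  set B' := B :&: e^-1 *: A; set A' := A :|: e *: B.
  have B'1 : 1 \in B' by rewrite inE B1 mem_lcoset invgK mulg1.
  have ltB : #|B'| < m.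
    apply: leq_trans Bm; apply: proper_card; rewrite properE subsetIl /=.
    by apply: contra nB => /subsetP s; apply/subsetP=> x /s; rewrite inE => /andP [].
  have [X [aX XAB kX]] := IH A' B' ltB (subsetP (subsetUl _ _) _ aA) B'1.
  exists X; split=> //.
    apply: subset_trans XAB _; apply/subsetP=> z /mulsgP [x y].
    rewrite !inE => /orP [xA|/lcosetP [b bB ->]] /andP [yB yA] ->; first exact: mem_mulg.
    move: yA; rewrite mem_lcoset invgK => yA.
    by rewrite -mulgA (mC b) mulgA mem_mulg.
  apply: leq_trans kX; rewrite /A' /B' cardsU card_lcoset.
  have -> : #|B :&: e^-1 *: A| = #|A :&: e *: B|.
    rewrite -(card_lcoset _ e); congr #|pred_of_set _|; apply/setP=> x.
    by rewrite !inE !mem_lcoset inE mem_lcoset invgK mulKVg andbC.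
  have := subset_leq_card (subsetIl A (e *: B)); lia.
have sB : B \subset period A.
  apply/subsetP=> b bB; apply/periodP=> e eA.
  by have := nE e; rewrite eA negbK => /subsetP /(_ _ bB); rewrite mem_lcoset invgK.
exists A; split=> //; last by rewrite leq_add2l subset_leq_card.
by apply/subsetP=> x xA; rewrite -[x]mulg1 mem_mulg.
Qed.

(** Around [a * b], the translates [A :* b] and [b^-1 *: B] have the same product set, and the
    second contains 1 as Dyson's transform requires; [period_cover] glues the local bounds. *)
Lemma kneser_weak A B : A != set0 -> B != set0 ->
  #|A| + #|B| <= #|A * B| + #|period (A * B)|.
Proof.
move=> /set0Pn [a0 a0A] /set0Pn [b0 b0B]; apply: period_cover.
  by apply/set0Pn; exists (a0 * b0); apply: mem_mulg.
move=> c /mulsgP [a b aA bB ->].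
have ab : a * b \in A :* b by rewrite mem_rcoset mulgK.
have bb : 1 \in b^-1 *: B by rewrite mem_lcoset invgK mulg1.
have [X [aX sX kX]] := dyson_cover ab bb.
rewrite card_rcoset card_lcoset in kX; exists X; split=> //.
apply: subset_trans sX _; apply/subsetP=> z /mulsgP [x y].
rewrite mem_rcoset mem_lcoset invgK => xA yB ->.
by have -> : x * y = (x * b^-1) * (b * y); rewrite ?mem_mulg // mulgA mulgKV.
Qed.

(** This is the weak form for [A * H] and [B * H], whose product is still [A * B]. *)
Theorem kneser A B : A != set0 -> B != set0 ->
  #|A * period (A * B)| + #|B * period (A * B)| <= #|A * B| + #|period (A * B)|.
Proof.
move=> A0 B0; set H := period (A * B).
have AH0 X : X != set0 -> X * H != set0.
  by case/set0Pn=> x xX; apply/set0Pn; exists (x * 1); rewrite mem_mulg // group1.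
have E : (A * H) * (B * H) = A * B.
  by rewrite -mulgA (mulgA H) (smC H) -mulgA (mulGid [group of H]) mulgA mul_period.
by have := kneser_weak (AH0 _ A0) (AH0 _ B0); rewrite E.
Qed.
End Kneser.

(** * Numerical semigroups avoiding [2 n - t] *)

Definition cnt (G : pred nat) a w := count G (iota a w).

Lemma cntD G a w w' : cnt G a (w + w') = cnt G a w + cnt G (a + w) w'.
Proof. by rewrite /cnt iotaD count_cat. Qed.

Lemma cnt_sum G a w : cnt G a w = \sum_(i < w) G (a + i).
Proof. by rewrite /cnt -sum1_count big_mkcond -{1}(addn0 a) iotaDl big_map -{1}[w]subn0 big_mkord. Qed.

Lemma cnt_card G a w : cnt G a w = #|[set i : 'I_w | G (a + i)]|.
Proof.
rewrite cnt_sum -sum1dep_card [RHS]big_mkcond.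
by apply: eq_bigr => i _; case: (G _).
Qed.

Lemma cnt_le G a w : cnt G a w <= w.
Proof. by rewrite /cnt -{2}(size_iota a w) count_size. Qed.

Lemma leq_cnt G a b w v : b <= a -> a + w <= b + v -> cnt G a w <= cnt G b v.
Proof.
move=> ba aw; have -> : v = (a - b) + (w + (b + v - (a + w))) by lia.
by rewrite !cntD subnKC // addnCA leq_addr.
Qed.

(** Adding the count to its mirror image under [i -> l - i] gives terms that are at most 1. *)
Lemma cnt_sym G b l : (forall i j, i + j = l -> ~~ (G (b + i) && G (b + j))) ->
  2 * cnt G b l.+1 <= l.+1.
Proof.
move=> H; rewrite mul2n -addnn cnt_sum.
rewrite [X in X + _](reindex_inj rev_ord_inj) -big_split /=.
rewrite -[X in _ <= X]card_ord -sum1_card; apply: leq_sum => i _; rewrite subSS.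
have /H : (l - i) + i = l by rewrite subnK // -ltnS.
by case: (G _); case: (G _).
Qed.

(** * Arithmetic of the window estimates *)

Lemma arith_pair a b c h u v d s :
  a + b <= c + h -> u * h <= a -> v * h <= b -> c + c + h <= s -> d * h = s ->
  2 * (u + v) * h <= d.+1 * h.
Proof. by move=> ? ? ? ? ds; rewrite [d.+1 * h]mulSn ds -mulnA mulnDl; lia. Qed.

Lemma arith_triple a b c h u v d s :
  a + b <= c + h -> u * h <= a -> v * h <= b -> c + a <= s -> d * h = s ->
  (2 * u + v) * h <= d.+1 * h.
Proof. by move=> ? ? ? ? ds; rewrite [d.+1 * h]mulSn ds mulnDl -mulnA; lia. Qed.

Lemma quotient_le t e d q : t <= e * e -> q * d = t -> e < d -> q <= e.
Proof.
move=> te qd ed; rewrite leqNgt; apply/negP=> eq.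
by have := leq_trans (ltn_mul eq ed) (leq_trans (eq_leq qd) te); rewrite ltnn.
Qed.

(* In the next four lemmas the letters [A], [B], [C], [C'] are numbers of elements in windows
   of length [t] or [h] met by [u] or [v] classes modulo [d], with [q = t / d] and [k] the
   ceiling of [h / d].  Either [d <= e], and counting by classes loses at most [d]; or
   [q <= e], and the class bound for full windows is the generic one up to [q]. *)
Lemma mid_arith_odd A B C t h e d u v q k : t <= e * e -> h <= t -> 0 < u -> 0 < v ->
  2 * (u + v) <= d.+1 -> 2 * C <= h.+1 ->
  q * d = t -> k <= q -> h <= k * d -> k * d <= h + d.-1 ->
  C <= u * k -> B <= v * q -> A <= u * q ->
  6 * (A + B + C) <= 4 * t + 2 * h + 6 * e + 3.
Proof.
move=> te ht u0 v0 uv ch qd kq hk kd hC hB hA.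
have S : 2 * (A + B) <= d.+1 * q by have := leq_mul uv (leqnn q); lia.
have [de|ed] := leqP d e; last first.
  have qe := quotient_le te qd ed.
  lia.
have S2 : 2 * C <= d.-1 * k.
  have u1 : 2 * u <= d.-1 by lia.
  by have := leq_mul u1 (leqnn k); lia.
have [d' Ed] : exists d', d = d' + 3 by exists (d - 3); lia.
subst d t; have := leq_mul (leqnn d') kq; rewrite addn3 /= in S S2 hk kd de *; lia.
Qed.

Lemma mid_arith_even A B C C' t h e d u v q k : t <= e * e -> h <= t -> 0 < u -> 0 < v ->
  2 * (u + v) <= d.+1 -> C + C' <= h.+1 ->
  q * d = t -> k <= q -> h <= k * d -> k * d <= h + d.-1 ->
  C <= u * k -> C' <= v * k -> B <= v * q -> A <= u * q ->
  6 * (A + B) <= 2 * t + 2 * h + 3 * e \/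
  6 * (A + B + C + C') <= 4 * t + 4 * h + 6 * e + 6.
Proof.
move=> te ht u0 v0 uv ch qd kq hk kd hC hC' hB hA.
have S : 2 * (A + B) <= d.+1 * q by have := leq_mul uv (leqnn q); lia.
have [de|ed] := leqP d e; last first.
  have qe := quotient_le te qd ed.
  have [h2|h2] := leqP t (2 * h); [left|right]; lia.
right; have S2 : 2 * (C + C') <= d.+1 * k by have := leq_mul uv (leqnn k); lia.
have d3 : 3 <= d by lia.
have := leq_mul d3 (leqnn k); have := leq_mul d3 (leqnn q); lia.
Qed.

Lemma low3_arith A C t h e d u v q k : t <= e * e -> 2 < d -> 0 < v -> 2 * u + v <= d.+1 -> v <= u ->
  2 * C <= h.+1 -> h < t ->
  q * d = t -> k <= q -> h <= k * d -> k * d <= h + d.-1 -> C <= v * k -> A <= u * q ->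
  6 * (A + C) <= 3 * t + 2 * h + 6 * e + 3.
Proof.
move=> te d2 v0 uv vu ch ht qd kq hk kd hC hA.
have S : 2 * A + v * q <= d.+1 * q by have := leq_mul uv (leqnn q); lia.
have [de|ed] := leqP d e; last first.
  have qe := quotient_le te qd ed.
  have := leq_mul (leqnn v) kq; lia.
have [v1|v1] := leqP v 1.
  have {v0 v1}v1 : v = 1 by lia.
  subst v; have := leq_mul d2 (leqnn k); lia.
have S2 : 3 * C <= d.+1 * k.
  have v3 : 3 * v <= d.+1 by lia.
  by have := leq_mul v3 (leqnn k); lia.
have := leq_mul v1 (leqnn q); lia.
Qed.

Lemma low2_arith C t h e d u v q k : t <= e * e -> 2 < d -> 0 < v -> 2 * u + v <= d.+1 -> v <= u ->
  3 * C <= 2 * h + 3 -> h < t ->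
  q * d = t -> k <= q -> h <= k * d -> k * d <= h + d.-1 -> C <= v * k ->
  6 * C <= t + 2 * h + 3 * e + 6.
Proof.
move=> te d2 v0 uv vu ch ht qd kq hk kd hC.
have S : 3 * C <= d.+1 * k.
  have v3 : 3 * v <= d.+1 by lia.
  by have := leq_mul v3 (leqnn k); lia.
have [de|ed] := leqP d e; last first.
  have qe := quotient_le te qd ed.
  have := leq_mul (leqnn d.+1) kq; lia.
have := leq_mul d2 (leqnn q); lia.
Qed.

(** * Windows and sumsets in a numerical semigroup *)

Section Extremal.
Variables (n t' : nat) (G : pred nat).
Notation t := t'.+1.
Hypotheses (G0 : G 0) (GD : forall x y, G x -> G y -> G (x + y)) (Gt : G t) (tn : t <= n).
Hypothesis GF : ~~ G (2 * n - t).

Lemma G_mult x k : G x -> G (x + k * t).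
Proof.
move=> Gx; elim: k => [|k IH]; first by rewrite addn0.
by rewrite mulSn addnCA addnC GD.
Qed.

(** Adding multiples of [t] to such an [s] would reach [2 * n - t]. *)
Lemma nosum s : G s -> s < 2 * n -> s = 2 * n %[mod t] -> False.
Proof.
move=> Gs s2 /eqP; rewrite eq_sym eqn_mod_dvd 1?ltnW // => /dvdnP [k Ek].
move/negP: GF; apply; case: k Ek => [|k] Ek; first by lia.
have -> : 2 * n - t = s + k * t by lia.
exact: G_mult.
Qed.

Lemma cnt_shift a w g : G g -> cnt G a w <= cnt G (a + g) w.
Proof.
move=> Gg; rewrite !cnt_sum; apply: leq_sum => i _.
case E: (G (a + i)) => //; suff -> : G (a + g + i) by [].
by rewrite addnAC GD.
Qed.

(** Let [a + i] be the least element of the first window and [a' + j] the greatest of the second.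
    Translating each set by the extreme element of the other gives two sets of sums that overlap at
    most in [a + a' + i + j]. *)
Lemma cnt_add a a' w w' : 0 < cnt G a w -> 0 < cnt G a' w' ->
  cnt G a w + cnt G a' w' <= (cnt G (a + a') (w + w').-1).+1.
Proof.
rewrite -!has_count => /hasP [x xw Gx] /hasP [y yw Gy].
move: xw yw; rewrite !mem_iota => xw yw.
have exi : exists i, (i < w) && G (a + i) by exists (x - a); rewrite subnKC; lia.
have exj : exists i, (i < w') && G (a' + i) by exists (y - a'); rewrite subnKC; lia.
case: (ex_minnP exi) => i /andP [iw Gi] mini.
have ubj : forall j, (j < w') && G (a' + j) -> j <= w' by move=> j /andP [/ltnW].
case: (ex_maxnP exj ubj) => j /andP [jw Gj] maxj.
have -> : cnt G a w = cnt G (a + i) (w - i).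
  have {1}-> : w = i + (w - i) by lia.
  rewrite cntD [cnt G a i]cnt_sum big1 // => k _; apply/eqP; rewrite eqb0.
  by apply: contraTN (ltn_ord k) => Gk; rewrite -leqNgt mini // Gk (ltn_trans _ iw).
have -> : cnt G a' w' = cnt G a' j.+1.
  have {1}-> : w' = j.+1 + (w' - j.+1) by lia.
  rewrite cntD [X in _ + X]cnt_sum big1 ?addn0 // => k _; apply/eqP; rewrite eqb0.
  apply/negP=> Gk; have := maxj (j.+1 + k); rewrite addnA Gk andbT.
  by have := ltn_ord k; lia.
have s1 := cnt_shift (a + i) (w - i) Gj; have s2 := cnt_shift a' j.+1 Gi.
have L : cnt G (a + a' + i) (j + (w - i)) <= cnt G (a + a') (w + w').-1 by apply: leq_cnt; lia.
rewrite (_ : a + i + (a' + j) = a + a' + i + j) in s1; last by lia.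
rewrite (_ : a' + (a + i) = a + a' + i) in s2; last by lia.
have c1 : cnt G (a + a' + i) j.+1 = cnt G (a + a' + i) j + cnt G (a + a' + i + j) 1.
  by rewrite -cntD addn1.
rewrite cntD in L; have := cnt_le G (a + a' + i + j) 1; lia.
Qed.

(* Four terms from windows of length [h] reach the forbidden value [2 * n - 2 * t] exactly
   at the centre of their range, so the sumset of two windows fills at most half of its own. *)
Lemma cnt_window a a' h : a + a' + h + t = n -> cnt G a h + cnt G a' h <= h.+1.
Proof.
move=> E; case: (posnP (cnt G a h)) => [->|p]; first by rewrite add0n leqW // cnt_le.
case: (posnP (cnt G a' h)) => [->|p']; first by rewrite addn0 leqW // cnt_le.
apply: leq_trans (cnt_add p p') _; rewrite ltnS.
(* The sumset window has length [2 * h - 1]; extending it to [2 * h + 1] puts [n - t] at its centre,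
   so mirror positions add up to [2 * n - 2 * t]. *)
apply: (@leq_trans (cnt G (a + a') (2 * h).+1)); first by apply: leq_cnt => //; lia.
suff : 2 * cnt G (a + a') (2 * h).+1 <= (2 * h).+1 by lia.
apply: cnt_sym => i j Eij; apply/negP=> /andP [Gi Gj].
move/negP: GF; apply.
have -> : 2 * n - t = (a + a' + i) + (a + a' + j) + t by lia.
exact: (GD (GD Gi Gj) Gt).
Qed.

(** * Residue classes modulo [t] and its divisors *)

Definition res (x : nat) : 'I_t := inZp x.

(** The group law of ['I_t] is addition modulo [t], written multiplicatively; products of residue
    sets below are thus sumsets. *)
Lemma resD x y : res (x + y) = (res x * res y)%g.
Proof. by apply/val_inj; rewrite /= modnDm. Qed.

Lemma res_eq x y : res x = res y <-> x = y %[mod t].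
Proof. by split=> [/(congr1 val)|H] //; apply/val_inj. Qed.

Lemma abelian_res : abelian [set: 'I_t].
Proof. by apply/centsP=> x _ y _; apply/val_inj; rewrite /= addnC. Qed.

Definition residues b : {set 'I_t} := locked [set r | [exists y : 'I_b, G y && (res y == r)]].

Lemma in_residues b r : reflect (exists y, [/\ y < b, G y & res y = r]) (r \in residues b).
Proof.
rewrite /residues -lock inE; apply: (iffP existsP) => [[y /andP [Gy /eqP E]]|[y [yb Gy E]]].
  by exists y.
by exists (Ordinal yb); rewrite /= Gy E eqxx.
Qed.

Lemma residues1 b : 0 < b -> 1%g \in residues b.
Proof. by move=> b0; apply/in_residues; exists 0; split=> //; apply/val_inj; rewrite /= mod0n. Qed.

Lemma sub_residues a b : a <= b -> residues a \subset residues b.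
Proof.
by move=> ab; apply/subsetP=> r /in_residues [y [yb Gy E]]; apply/in_residues; exists y; rewrite (leq_trans yb).
Qed.

Lemma mul_residues a b : (residues a * residues b)%g \subset residues (a + b).-1.
Proof.
apply/subsetP=> z /mulsgP [r s /in_residues [x [xa Gx <-]] /in_residues [y [yb Gy <-]] ->].
by apply/in_residues; exists (x + y); rewrite resD GD //; split=> //; lia.
Qed.

Lemma mul_residues_target a b r s : a + b <= 2 * n -> r \in residues a -> s \in residues b -> (r * s)%g <> res (2 * n).
Proof.
move=> ab /in_residues [x [xa Gx <-]] /in_residues [y [yb Gy <-]].
by rewrite -resD => /res_eq; apply: nosum; [exact: GD | lia].
Qed.

(** Reduction modulo [d], kept inside ['I_t] so that all divisors [d] share one type. *)
Definition cls d (r : 'I_t) : 'I_t := res (r %% d).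

Lemma cls_res d x y : d %| t -> cls d (res x) = cls d (res y) <-> x = y %[mod d].
Proof.
move=> dt; have d0 : 0 < d by apply: dvdn_gt0 dt.
rewrite /cls res_eq /= !(modn_dvdm _ dt).
have lt z : z %% d < t by apply: leq_trans (ltn_pmod z d0) (dvdn_leq _ dt).
by rewrite !(modn_small (lt _)).
Qed.

(** Elements of [H] are multiples of [d], so every class meeting [A] contains a whole coset of [H]
    inside [A * H]. *)
Lemma card_cls d (A : {set 'I_t}) (H : {group 'I_t}) : d %| t ->
  (forall h, h \in H -> d %| h) -> #|cls d @: A| * #|H| <= #|A * H|%g.
Proof.
move=> dt dH; rewrite -[X in _ <= X]sum1_card (partition_big_imset (cls d)) -sum_nat_const /=.
rewrite [X in _ <= X](bigID (mem (cls d @: A))) /=; apply: leq_trans (leq_addr _ _).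
have sA : cls d @: A \subset cls d @: (A * H)%g.
  by apply: imsetS; apply/subsetP=> x xA; rewrite -[x]mulg1 mem_mulg.
rewrite [X in _ <= X](eq_bigl (mem (cls d @: A))); last first.
  by move=> c; apply/andP/idP => [[]|cA] //; split=> //; apply: (subsetP sA).
apply: leq_sum => c /imsetP [r rA ->]; rewrite -(card_lcoset _ r) sum1dep_card.
apply: subset_leq_card; apply/subsetP=> x /lcosetP [h hH ->].
rewrite inE mem_mulg //=; apply/eqP.
have E (z : 'I_t) : z = res z by apply/val_inj; rewrite /= modn_small.
rewrite {1}(E r) {1}(E h) -resD {2}(E r); apply/cls_res => //.
by rewrite -modnDmr (eqP (dH _ hH)) addn0.
Qed.

Definition ceil w d := (w + d.-1) %/ d.

(** A position [i] of the window is determined by the class of [a + i] modulo [d] and the block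
    [i %/ d], and there are [ceil w d] blocks. *)
Lemma cnt_cls d a w b : d %| t -> a + w <= b -> cnt G a w <= #|cls d @: residues b| * ceil w d.
Proof.
move=> dt awb; have d0 : 0 < d by apply: dvdn_gt0 dt.
case: w awb => [|w] awb; first by rewrite /cnt.
have ltc (i : 'I_w.+1) : i %/ d < ceil w.+1 d.
  rewrite /ceil; have -> : w.+1 + d.-1 = w + d by lia.
  by rewrite divnDr // divnn d0 addn1 ltnS leq_div2r // -ltnS.
rewrite cnt_card -{1}[ceil _ _]card_ord -cardsT -cardsX.
pose f (i : 'I_w.+1) := (cls d (res (a + i)), Ordinal (ltc i)).
have fi : injective f.
  move=> i j E; have /(proj1 (cls_res _ _ dt)) /eqP := congr1 fst E.
  rewrite eqn_modDl => /eqP E1; have [E2] := congr1 snd E.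
  by apply/val_inj; rewrite /= (divn_eq i d) (divn_eq j d) E1 E2.
rewrite -(card_imset _ fi); apply: subset_leq_card; apply/subsetP=> z /imsetP [i].
rewrite inE => Gi ->; rewrite !inE andbT; apply: imset_f; apply/in_residues; exists (a + i).
by split=> //; apply: leq_trans awb; rewrite ltn_add2l.
Qed.

Lemma group_dvd (H : {group 'I_t}) h : h \in H -> t %/ #|H| %| h.
Proof.
move=> hH; have /dvdnP [d Ed] : #|H| %| t by have := cardSg (subsetT H); rewrite cardsT card_ord.
have -> : t %/ #|H| = d by rewrite {1}Ed mulnK ?cardG_gt0.
have /(congr1 val) /= : (h ^+ #|H| = 1)%g by exact: expg_cardG.
rewrite Zp_expg /= => /eqP; rewrite -[_ == _]/(t %| h * #|H|).
by rewrite {1}Ed dvdn_pmul2r // cardG_gt0.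
Qed.

Lemma ceil_self d : d %| t -> ceil t d = t %/ d.
Proof.
move=> dt; have d0 : 0 < d by apply: dvdn_gt0 dt.
have small : d.-1 < d by rewrite prednK.
by rewrite /ceil -{1}(divnK dt) divnMDl // (divn_small small) addn0.
Qed.

(** What is kept of the group structure: below [x], windows are as sparse as if [G] met only [u]
    classes modulo [d]. *)
Definition thin x d u := forall a w, a + w <= x -> cnt G a w <= u * ceil w d.

(** The residues of elements below [n] avoid their reflection in [2 * n], so they fill at most half
    of Z/t, and a window of length [t] meets each class once. *)
Lemma half_window a : a + t <= n -> 2 * cnt G a t <= t.
Proof.
move=> an; pose D := [set res (2 * n) * r^-1 | r in residues n]%g.
have cR : cnt G a t <= #|residues n|.
  apply: leq_trans (cnt_cls (dvdnn t) an) _.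
  by rewrite ceil_self // divnn muln1 leq_imset_card.
have d1 : residues n :&: D = set0.
  apply/setP=> x; rewrite !inE; apply/negP=> /andP [xR /imsetP [r rR Ex]].
  by apply: (@mul_residues_target n n x r) => //; [lia | rewrite Ex mulgKV].
have cD : #|D| = #|residues n| by rewrite card_imset // => x y /mulgI /invg_inj.
suff : #|residues n| + #|residues n| <= t by lia.
rewrite -{2}cD -cardsUI d1 cards0 addn0 -[X in _ <= X]card_ord; exact: max_card.
Qed.

(* With [C = residues x + residues y] and [H] its period, the sets [C], [2n - C] and [n + H]
   are pairwise disjoint in [Z/t]; the third one is what forces [d >= 3]. *)
Lemma pair_thin x y : 0 < x -> 0 < y -> x + y <= n ->
  exists d u v, [/\ d %| t, 0 < u, 0 < v, 2 * (u + v) <= d.+1 & thin x d u /\ thin y d v].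
Proof.
move=> x0 y0 xyn; set C := (residues x * residues y)%g; pose H := period_group C.
have CR : C \subset residues n by apply: subset_trans (mul_residues x y) (sub_residues _); lia.
have RN1 : 1%g \in residues x by exact: residues1.
have RN2 : 1%g \in residues y by exact: residues1.
have Rx0 : residues x != set0 by apply/set0Pn; exists 1%g.
have Ry0 : residues y != set0 by apply/set0Pn; exists 1%g.
have Kn := kneser abelian_res Rx0 Ry0.
have Ht : #|H| %| t by have := cardSg (subsetT H); rewrite cardsT card_ord.
have dt : t %/ #|H| %| t by apply/dvdnP; exists #|H|; rewrite mulnC divnK.
have cx := card_cls (residues x) dt (@group_dvd H); have cy := card_cls (residues y) dt (@group_dvd H).
(* [d] is the index of the period [H], all of whose elements are multiples of [d]. *)
exists (t %/ #|H|), #|cls (t %/ #|H|) @: residues x|, #|cls (t %/ #|H|) @: residues y|.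
split=> //; try by rewrite card_gt0; apply/set0Pn; eexists; apply: imset_f; eassumption.
  pose D := [set res (2 * n) * c^-1 | c in C]%g; pose F := (res n *: H)%g.
  have cD : #|D| = #|C| by rewrite card_imset // => a b /mulgI /invg_inj.
  have nn : res (2 * n) = (res n * res n)%g by rewrite -resD addnn mul2n.
  have n2 : n + n <= 2 * n by rewrite mul2n addnn.
  have CC a b : a \in C -> b \in C -> (a * b)%g <> res (2 * n).
    by move=> /(subsetP CR) aR /(subsetP CR) bR; apply: mul_residues_target n2 aR bR.
  have mC (a b : 'I_t) : (a * b = b * a)%g by apply: (centsP abelian_res); rewrite inE.
  (* By periodicity, [n + h] in [C] would put [n] in [C], and [n + n] is the forbidden class. *)
  have nC h : h \in H -> (res n * h)%g \notin C.
    by move=> hH; rewrite (mem_period _ hH); apply/negP=> nC; apply: (CC _ _ nC nC).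
  have d1 : C :&: D = set0.
    apply/setP=> z; rewrite !inE; apply/negP=> /andP [zC /imsetP [c cC Ez]].
    by apply: (CC z c) => //; rewrite Ez mulgKV.
  have d2 : (C :|: D) :&: F = set0.
    apply/setP=> z; rewrite !inE; apply/negP=> /andP [CD /lcosetP [h hH Ez]].
    case/orP: CD => [|/imsetP [c cC]]; first by rewrite Ez; apply/negP; apply: nC.
    rewrite Ez nn => E; have : (res n * h^-1)%g \notin C by apply: nC; rewrite groupV.
    have -> : (res n * h^-1)%g = c; last by rewrite cC.
    move/(congr1 (fun z => z * c * h^-1)%g): E; rewrite mulgKV -!mulgA => /mulgI.
    by rewrite (mC c) mulgA mulgV mul1g => ->.
  have le_t : #|C :|: D :|: F| <= t by rewrite -[X in _ <= X]card_ord; exact: max_card.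
  have eF : #|C :|: D :|: F| = #|C :|: D| + #|H|.
    by rewrite -(card_lcoset H (res n)) -cardsUI d2 cards0 addn0.
  have eD : #|C :|: D| = #|C| + #|C| by rewrite -{2}cD -cardsUI d1 cards0 addn0.
  rewrite -(leq_pmul2r (cardG_gt0 H)); rewrite eF eD in le_t.
  apply: (@arith_pair _ _ _ _ _ _ _ _ Kn cx cy le_t); exact: divnK Ht.
by split=> a w aw; apply: cnt_cls.
Qed.

(** Sums of [C = residues x + residues y] with [residues x] stay below [2 * n], so [C] is disjoint
    from the reflection of [residues x + H] in [2 * n]; Kneser's theorem turns this into
    [2 * u + v <= d.+1]. *)
Lemma triple_thin x y : 0 < y -> y <= x -> 2 * x + y <= 2 * n ->
  exists d u v, [/\ d %| t, 2 < d, 0 < v, v <= u & [/\ 2 * u + v <= d.+1, thin x d u & thin y d v]].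
Proof.
move=> y0 yx xyn; have x0 : 0 < x by exact: leq_trans yx.
set C := (residues x * residues y)%g; pose H := period_group C.
have RN1 : 1%g \in residues x by exact: residues1.
have RN2 : 1%g \in residues y by exact: residues1.
have Rx0 : residues x != set0 by apply/set0Pn; exists 1%g.
have Ry0 : residues y != set0 by apply/set0Pn; exists 1%g.
have Kn := kneser abelian_res Rx0 Ry0.
have Ht : #|H| %| t by have := cardSg (subsetT H); rewrite cardsT card_ord.
have dt : t %/ #|H| %| t by apply/dvdnP; exists #|H|; rewrite mulnC divnK.
have cx := card_cls (residues x) dt (@group_dvd H); have cy := card_cls (residues y) dt (@group_dvd H).
have mC (a b : 'I_t) : (a * b = b * a)%g by apply: (centsP abelian_res); rewrite inE.
have C1 : 1%g \in C by rewrite -[1%g]mulg1 mem_mulg.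
have xyx : (x + y).-1 + x <= 2 * n by lia.
have CA c r : c \in C -> r \in residues x -> (c * r)%g <> res (2 * n).
  by move=> /(subsetP (mul_residues x y)) cR rR; apply: mul_residues_target xyx cR rR.
have CAH c r h : c \in C -> r \in residues x -> h \in H -> (c * (r * h))%g <> res (2 * n).
  by move=> cC rR hH; rewrite (mC r) mulgA; apply: CA; rewrite // (mem_period _ hH).
pose D := [set res (2 * n) * c^-1 | c in (residues x * H)%g]%g.
have cD : #|D| = #|residues x * H|%g by rewrite card_imset // => a b /mulgI /invg_inj.
have d1 : C :&: D = set0.
  apply/setP=> z; rewrite !inE; apply/negP=> /andP [zC /imsetP [c cC Ez]].
  case/mulsgP: cC Ez => r h rR hH -> Ez.
  by apply: (CAH z r h) => //; rewrite Ez mulgKV.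
have le_t : #|C| + #|residues x * H|%g <= t.
  rewrite -cD -cardsUI d1 cards0 addn0 -[X in _ <= X]card_ord; exact: max_card.
have nH : res (2 * n) \notin H.
  by apply/negP=> nH; apply: (CAH 1 1 (res (2 * n)))%g => //; rewrite !mul1g.
(* If the period had index 2, twice [n] would lie in it, but [2 * n] is outside [H]. *)
have d2 : t %/ #|H| != 2.
  apply/eqP=> dE; have tE : 2 * #|H| = t by rewrite -dE divnK.
  have nn : res (2 * n) = (res n * res n)%g by rewrite -resD addnn mul2n.
  have n1H : res n \notin H by apply: contra nH => nH1; rewrite nn groupM.
  have : H :|: (res n *: H)%g == setT.
    rewrite eqEcard subsetT cardsT card_ord /=.
    have dis : H :&: (res n *: H)%g = set0.
      apply/setP=> z; rewrite !inE mem_lcoset; apply/negP=> /andP [zH nzH].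
      by move/negP: n1H; apply; rewrite -groupV -(groupMr _ zH).
    have := cardsUI H (res n *: H)%g; rewrite dis cards0 card_lcoset addn0.
    by rewrite addnn -mul2n tE => ->.
  move/eqP/setP/(_ (res (2 * n))); rewrite !inE (negbTE nH) mem_lcoset nn mulKg.
  by rewrite (negbTE n1H).
exists (t %/ #|H|), #|cls (t %/ #|H|) @: residues x|, #|cls (t %/ #|H|) @: residues y|.
have uv : 2 * #|cls (t %/ #|H|) @: residues x| + #|cls (t %/ #|H|) @: residues y| <= (t %/ #|H|).+1.
  rewrite -(leq_pmul2r (cardG_gt0 H)).
  apply: (@arith_triple _ _ _ _ _ _ _ _ Kn cx cy le_t); exact: divnK Ht.
have v0 : 0 < #|cls (t %/ #|H|) @: residues y|.
  by rewrite card_gt0; apply/set0Pn; eexists; apply: imset_f RN2.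
have vu : #|cls (t %/ #|H|) @: residues y| <= #|cls (t %/ #|H|) @: residues x|.
  by apply/subset_leq_card/imsetS/sub_residues.
split=> //; first by move: d2 uv v0 vu; lia.
by split=> // a w aw; apply: cnt_cls.
Qed.

(** * Tilings of the interval by windows *)

Variable e : nat.
Hypothesis te : t <= e * e.
Hypothesis Gmin : forall x, 0 < x < t -> ~~ G x.

Lemma ceil_bounds w d : 0 < d -> w <= ceil w d * d <= w + d.-1.
Proof.
move=> d0; rewrite leq_trunc_div andbT /ceil.
by have := ltn_ceil (w + d.-1) d0; lia.
Qed.

Lemma ceil_le w d : d %| t -> w <= t -> ceil w d <= t %/ d.
Proof. by move=> dt wt; rewrite -ceil_self // leq_div2r // leq_add2r. Qed.

(** As [d >= 3], the proportion [d.+1 / (2 * d)] of classes is at most 2/3. *)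
Lemma two_windows x y : 0 < x -> 0 < y -> x + y <= n -> forall a b,
  a + t <= x -> b + t <= y -> 3 * (cnt G a t + cnt G b t) <= 2 * t.
Proof.
move=> x0 y0 xy a b ax bY; have [d [u [v [dt u0 v0 uv [tx ty]]]]] := pair_thin x0 y0 xy.
have := tx _ _ ax; have := ty _ _ bY; rewrite ceil_self // => hb ha.
have := divnK dt; have := leq_mul uv (leqnn (t %/ d)).
have d3 : 3 <= d by lia.
by have := leq_mul d3 (leqnn (t %/ d)); lia.
Qed.

Lemma odd_mid x y a b c h : 0 < x -> 0 < y -> x + y <= n -> h <= t ->
  a + t <= x -> b + t <= y -> c + h <= x -> 2 * cnt G c h <= h.+1 ->
  6 * (cnt G a t + cnt G b t + cnt G c h) <= 4 * t + 2 * h + 6 * e + 3.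
Proof.
move=> x0 y0 xy ht ax bY cx ch; have [d [u [v [dt u0 v0 uv [tx ty]]]]] := pair_thin x0 y0 xy.
have d0 : 0 < d by exact: dvdn_gt0 dt.
have := tx _ _ ax; have := ty _ _ bY; have := tx _ _ cx; rewrite ceil_self //.
have /andP [hk kd] := ceil_bounds h d0; have kq := ceil_le dt ht; have qd := divnK dt.
by move=> hC hB hA; apply: mid_arith_odd te ht u0 v0 uv ch qd kq hk kd hC hB hA.
Qed.

Lemma even_mid x y a b c c' h : 0 < x -> 0 < y -> x + y <= n -> h <= t ->
  a + t <= x -> b + t <= y -> c + h <= x -> c' + h <= y -> cnt G c h + cnt G c' h <= h.+1 ->
  6 * (cnt G a t + cnt G b t) <= 2 * t + 2 * h + 3 * e \/
  6 * (cnt G a t + cnt G b t + cnt G c h + cnt G c' h) <= 4 * t + 4 * h + 6 * e + 6.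
Proof.
move=> x0 y0 xy ht ax bY cx cy ch; have [d [u [v [dt u0 v0 uv [tx ty]]]]] := pair_thin x0 y0 xy.
have d0 : 0 < d by exact: dvdn_gt0 dt.
have := tx _ _ ax; have := ty _ _ bY; have := tx _ _ cx; have := ty _ _ cy; rewrite ceil_self //.
have /andP [hk kd] := ceil_bounds h d0; have kq := ceil_le dt ht; have qd := divnK dt.
by move=> hC' hC hB hA; apply: mid_arith_even te ht u0 v0 uv ch qd kq hk kd hC hC' hB hA.
Qed.

(** The range from [t] to [n - t] is a short window followed by a full one; [triple_thin] bounds
    both at once, its size condition amounting to [h <= t]. *)
Lemma low3 h : n = 3 * t + h -> h < t ->
  6 * (cnt G (t + h) t + cnt G t h) <= 3 * t + 2 * h + 6 * e + 3.
Proof.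
move=> nE ht.
have ch : cnt G t h + cnt G t h <= h.+1 by apply: cnt_window; lia.
have [|||d [u [v [dt d2 v0 vu [uv tx ty]]]]] := @triple_thin (2 * t + h) (t + h); try lia.
have d0 : 0 < d by exact: dvdn_gt0 dt.
have := tx (t + h) t; have := ty t h (leqnn _); rewrite ceil_self // => hC hA.
have {}hA : cnt G (t + h) t <= u * (t %/ d) by apply: hA; lia.
have /andP [hk kd] := ceil_bounds h d0; have kq := ceil_le dt (ltnW ht); have qd := divnK dt.
by apply: low3_arith te d2 v0 uv vu _ ht qd kq hk kd hC hA; lia.
Qed.

(** Let [t + p] be the greatest element of the window. Either [p] is at most [2 * h / 3], or the
    elements from [t + 2 * (h - p)] up to [t + p] pair off, since a mirror pair together with
    [t + p] sums to [2 * n - t]. *)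
Lemma low2_bound h : n = 2 * t + h -> h < t -> 3 * cnt G t h <= 2 * h + 3.
Proof.
move=> nE ht; case: (posnP (cnt G t h)) => [->|]; first by lia.
rewrite -has_count => /hasP [x xw Gx]; move: xw; rewrite mem_iota => xw.
have exi : exists i, (i < h) && G (t + i) by exists (x - t); rewrite subnKC ?Gx ?andbT; lia.
have ub : forall j, (j < h) && G (t + j) -> j <= h by move=> j /andP [/ltnW].
case: (ex_maxnP exi ub) => p /andP [ph Gp] maxp.
have E : cnt G t h = cnt G t p.+1.
  have {1}-> : h = p.+1 + (h - p.+1) by lia.
  rewrite cntD [X in _ + X]cnt_sum big1 ?addn0 // => k _; apply/eqP; rewrite eqb0.
  apply/negP=> Gk; have := maxp (p.+1 + k); rewrite addnA Gk andbT.
  by have := ltn_ord k; lia.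
have [p3|p3] := leqP (3 * p) (2 * h); first by have := cnt_le G t p.+1; lia.
have Ep : p.+1 = (2 * h - 2 * p) + (3 * p - 2 * h).+1 by lia.
rewrite E Ep cntD; have := cnt_le G t (2 * h - 2 * p).
suff : 2 * cnt G (t + (2 * h - 2 * p)) (3 * p - 2 * h).+1 <= (3 * p - 2 * h).+1 by lia.
apply: cnt_sym => i j ij; apply/negP=> /andP [Gi Gj]; move/negP: GF; apply.
have -> : 2 * n - t = (t + (2 * h - 2 * p) + i) + (t + (2 * h - 2 * p) + j) + (t + p) by lia.
exact: (GD (GD Gi Gj) Gp).
Qed.

Lemma low2 h : n = 2 * t + h -> h < t -> 6 * cnt G t h <= t + 2 * h + 3 * e + 6.
Proof.
move=> nE ht; have hP := low2_bound nE ht.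
have [|||d [u [v [dt d2 v0 vu [uv tx ty]]]]] := @triple_thin (t + h) (t + h); try lia.
have d0 : 0 < d by exact: dvdn_gt0 dt.
have hC := ty t h (leqnn _).
have /andP [hk kd] := ceil_bounds h d0; have kq := ceil_le dt (ltnW ht); have qd := divnK dt.
exact: low2_arith te d2 v0 uv vu hP ht qd kq hk kd hC.
Qed.

(** The windows are peeled off upwards from [t] and downwards from [n - 2 * t]; the right ends of
    two partners add up to [n]. *)
Lemma paired_windows j : j.+2 * t <= n ->
  3 * (cnt G (n - j.+2 * t) (j * t) + cnt G t (j * t)) <= 2 * t * j.
Proof.
elim: j => [|j IH] jn; first by rewrite mul0n /cnt.
rewrite mulSn in jn; have jn' : j.+2 * t <= n by lia.
have {}IH := IH jn'.
have W : 3 * (cnt G (n - (t + j.+2 * t)) t + cnt G (t + j * t) t) <= 2 * t.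
  apply: (@two_windows (n - j.+2 * t) (j.+2 * t)); try by rewrite ?mulSn; lia.
rewrite mulSn.
have -> : cnt G (n - (t + j.+2 * t)) (j.+1 * t) =
          cnt G (n - (t + j.+2 * t)) t + cnt G (n - j.+2 * t) (j * t).
  by rewrite (mulSn j t) cntD; congr (_ + cnt G _ _); lia.
have -> : cnt G t (j.+1 * t) = cnt G t (j * t) + cnt G (t + j * t) t.
  by rewrite (mulSn j t) [t + _ in LHS]addnC cntD.
by rewrite (mulnS (2 * t)); lia.
Qed.

Lemma cnt_low : cnt G 0 t <= 1.
Proof.
rewrite -[t]add1n cntD [X in _ + X]cnt_sum big1 ?addn0 ?cnt_le // => k _.
apply/eqP; rewrite eqb0; apply: Gmin; have := ltn_ord k; lia.
Qed.

Lemma extremal : 3 * cnt G 0 n <= n + 3 * e + 9.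
Proof.
have [h ht nE] : exists2 h, h < t & n = n %/ t * t + h.
  by exists (n %% t); [rewrite ltn_mod | exact: divn_eq].
(* The first window has at most one element and each of the last two at most [t / 2], which together
   is about a third of [3 * t]; with three or more full windows, the rest then needs density 1/3. *)
have low := cnt_low.
have r0 : 2 * cnt G (n - t) t <= t by apply: half_window; lia.
have nlow : cnt G 0 n = cnt G 0 t + cnt G t (n - t) by rewrite -[t in RHS]add0n -cntD; congr cnt; lia.
have m0 : 0 < n %/ t by rewrite divn_gt0.
have [m1|m2] := leqP (n %/ t) 1.
  have E1 : n %/ t = 1 by lia.
  rewrite E1 mul1n in nE.
  (* The count from [t] to [n] is at most [n - t] and at most [t / 2]; one copy of the first bound
     and two of the second give [n]. *)
  have := cnt_le G t (n - t); have : cnt G t (n - t) <= cnt G (n - t) t by apply: leq_cnt; lia.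
  lia.
have n2 : 2 * t <= n by have := leq_mul m2 (leqnn t); lia.
have ntop : cnt G t (n - t) = cnt G t (n - 2 * t) + cnt G (n - t) t.
  have E : n - t = (n - 2 * t) + t by lia.
  by rewrite {1}E cntD; congr (_ + cnt G _ _); lia.
have [m2'|m3] := leqP (n %/ t) 2.
  have E2 : n %/ t = 2 by lia.
  rewrite E2 in nE; have := low2 nE ht; rewrite (_ : h = n - 2 * t); lia.
have n3 : 3 * t <= n by have := leq_mul m3 (leqnn t); lia.
have r1 : 2 * cnt G (n - 2 * t) t <= t by apply: half_window; lia.
have nsec : cnt G t (n - 2 * t) = cnt G t (n - 3 * t) + cnt G (n - 2 * t) t.
  have E : n - 2 * t = (n - 3 * t) + t by lia.
  by rewrite {1}E cntD; congr (_ + cnt G _ _); lia.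
have [m3'|m4] := leqP (n %/ t) 3.
  have E3 : n %/ t = 3 by lia.
  rewrite E3 in nE; have := low3 nE ht; rewrite (_ : t + h = n - 2 * t); last by lia.
  rewrite (_ : h = n - 3 * t) in nsec *; lia.
pose q := (n %/ t)./2.-2; have := odd_double_half (n %/ t).
have -> : (n %/ t)./2 = q.+2 by rewrite /q; lia.
(* Write [s = q * t].  Above [t] and below [n - 2 * t] lie [q] paired windows at either end
   and a middle part of length [2 * t + h] or [t + h], according to the parity of [n %/ t].
   In the even case the middle part is tiled in two ways, whose average is used, or covered
   by two overlapping windows. *)
case Eo: (odd (n %/ t)) => /= Eq; rewrite -Eq in nE.
  have Eh : n = 2 * (q * t) + 5 * t + h by rewrite {1}nE mulnA -mulnDl; congr (_ * t + h); lia.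
  have q2 : q.+2 * t = q * t + 2 * t by rewrite -mulnDl addn2.
  have := @paired_windows q; rewrite q2; move: (q * t) Eh {q2} => s Eh P.
  have {}P : 3 * (cnt G (n - (s + 2 * t)) s + cnt G t s) <= 2 * t * q by apply: P; lia.
  (* The short window sits in the middle, where [cnt_window] applies to it paired with itself. *)
  have M := @odd_mid (n - (s + 2 * t)) (s + 2 * t) (t + s + t + h) (t + s) (t + s + t) h.
  have {}M : 6 * (cnt G (t + s + t + h) t + cnt G (t + s) t + cnt G (t + s + t) h)
             <= 4 * t + 2 * h + 6 * e + 3.
    by apply: M; [..|rewrite mul2n -addnn; apply: cnt_window]; lia.
  have L : cnt G t (n - 3 * t) = cnt G t s + (cnt G (t + s) t + (cnt G (t + s + t) h +
             (cnt G (t + s + t + h) t + cnt G (t + s + t + h + t) s))).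
    by rewrite -!cntD; congr cnt; lia.
  rewrite (_ : t + s + t + h + t = n - (s + 2 * t)) in L; last by lia.
  lia.
have Eh : n = 2 * (q * t) + 4 * t + h by rewrite {1}nE mulnA -mulnDl; congr (_ * t + h); lia.
have q2 : q.+2 * t = q * t + 2 * t by rewrite -mulnDl addn2.
have := @paired_windows q; rewrite q2; move: (q * t) Eh {q2} => s Eh P.
have {}P : 3 * (cnt G (n - (s + 2 * t)) s + cnt G t s) <= 2 * t * q by apply: P; lia.
have M := @even_mid (n - (s + 2 * t)) (s + 2 * t) (t + s + h) (t + s) (t + s + t) (t + s) h.
have {}M : 6 * (cnt G (t + s + h) t + cnt G (t + s) t) <= 2 * t + 2 * h + 3 * e \/
    6 * (cnt G (t + s + h) t + cnt G (t + s) t + cnt G (t + s + t) h + cnt G (t + s) h)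
    <= 4 * t + 4 * h + 6 * e + 6.
  by apply: M; [..|apply: cnt_window]; lia.
have L : cnt G t (n - 3 * t) = cnt G t s + (cnt G (t + s) (t + h) + cnt G (n - (s + 2 * t)) s).
  rewrite (_ : n - (s + 2 * t) = t + s + (t + h)); last by lia.
  by rewrite -!cntD; congr cnt; lia.
have A := cntD G (t + s) t h.
have B : cnt G (t + s) (t + h) = cnt G (t + s) h + cnt G (t + s + h) t by rewrite -cntD (addnC h).
have hb : cnt G (t + s) h <= cnt G (t + s) t by apply: leq_cnt; lia.
lia.
Qed.
End Extremal.

(** * Containers *)

Definition gen (P : pred nat) (x : nat) : bool := `[< exists2 l : seq nat, all P l & sumn l = x >].

Lemma genP P x : reflect (exists2 l : seq nat, all P l & sumn l = x) (gen P x).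
Proof. exact: asboolP. Qed.

Lemma gen0 P : gen P 0.
Proof. by apply/genP; exists [::]. Qed.

Lemma gen1 (P : pred nat) x : P x -> gen P x.
Proof. by move=> Px; apply/genP; exists [:: x]; rewrite /= ?Px ?addn0. Qed.

Lemma genD P x y : gen P x -> gen P y -> gen P (x + y).
Proof.
move=> /genP [l Pl <-] /genP [l' Pl' <-]; apply/genP; exists (l ++ l').
  by rewrite all_cat Pl.
by rewrite sumn_cat.
Qed.

Lemma sub_gen (P Q : pred nat) : {subset P <= Q} -> {subset gen P <= gen Q}.
Proof. by move=> PQ x /genP [l Pl <-]; apply/genP; exists l => //; apply: sub_all Pl => y; apply: PQ. Qed.

Lemma gen_mul (P : pred nat) x k : P x -> gen P (k * x).
Proof. by move=> Px; elim: k => [|k IH]; [exact: gen0 | rewrite mulSn genD // gen1]. Qed.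

(** Among [m] or more terms, two prefix sums agree modulo [m]; the block between them sums to a
    multiple of [m] and is removed. *)
Lemma short_sum m (l : seq nat) : 0 < m ->
  exists k l', [/\ size l' < m, {subset l' <= l} & sumn l = k * m + sumn l'].
Proof.
move=> m0; have [N] := ubnP (size l); elim: N => // N IH in l *; rewrite ltnS => lN.
have [lm|ml] := ltnP (size l) m; first by exists 0, l; split.
pose f (i : 'I_m.+1) : 'I_m := Ordinal (ltn_pmod (sumn (take i l)) m0).
have /injectivePn [i [j ij fij]] : ~~ injectiveb f.
  by apply/injectiveP=> /leq_card; rewrite !card_ord ltnn.
wlog ltij : i j ij fij / i < j.
  move=> W; case: (ltngtP i j) => [|/W|/val_inj E]; first exact: W.
    by apply; rewrite 1?eq_sym.
  by rewrite E eqxx in ij.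
have jl : j <= size l by apply: leq_trans ml; rewrite -ltnS.
have Etj : sumn (take j l) = sumn (take i l) + sumn (drop i (take j l)).
  by rewrite -sumn_cat -{1}(cat_take_drop i (take j l)) take_takel // ltnW.
have /dvdnP [k Ek] : m %| sumn (drop i (take j l)).
  have /(congr1 val) /= /eqP := fij; rewrite Etj -{1}[sumn (take i l)]addn0 eqn_modDl.
  by rewrite mod0n eq_sym.
have [|k' [l' [l'm sl' El']]] := IH (take i l ++ drop j l).
  rewrite size_cat size_takel ?size_drop; last by apply: leq_trans jl; apply: ltnW.
  by apply: leq_trans lN; rewrite -{2}(subnKC jl) ltn_add2r.
exists (k + k'), l'; split=> // [x /sl'|].
  by rewrite mem_cat => /orP [/mem_take|/mem_drop].
rewrite sumn_cat in El'; have := congr1 sumn (cat_take_drop j l).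
by rewrite sumn_cat Etj Ek mulnDl => <-; lia.
Qed.

Lemma cnt_support (F : pred nat) v w : (forall x, F x -> x < w) -> cnt F 0 v <= cnt F 0 w.
Proof.
move=> H; have [vw|wv] := leqP v w; first exact: leq_cnt.
rewrite -(subnKC (ltnW wv)) cntD [X in _ + X]cnt_sum big1 ?addn0 // => i _.
by apply/eqP; rewrite eqb0; apply/negP=> /H; rewrite ltnNge leq_addr.
Qed.

Lemma cnt_rev (F : pred nat) l : cnt F 0 l.+1 = cnt (fun i => F (l - i)) 0 l.+1.
Proof.
rewrite !cnt_sum (reindex_inj rev_ord_inj); apply: eq_bigr => i _.
by rewrite !add0n /= subSS.
Qed.

Lemma sub_cnt (F F' : pred nat) a w : (forall x, F x -> F' x) -> cnt F a w <= cnt F' a w.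
Proof. by move=> FF'; apply: sub_count. Qed.

(** * Size of one container *)

Section Container.
Variables (n s v J : nat) (T : pred nat).
Notation S := (gen T).
Definition below x := T x && (x < v).
Definition excess c := cnt (fun z => S z && ~~ S (c + z)) 0 ((2 * n).+1 - c).
Definition closing c := [&& v <= c, c <= n, ~~ S (2 * n - c) & excess c <= s].
Notation Q := (gen (predU below closing)).

(** If [z] is in [S] and [a + b + z] is not, then [S] is left either on adding [b] to [z] or on
    adding [a] to [b + z]. *)
Lemma excessD a b : excess (a + b) <= excess a + excess b.
Proof.
rewrite /excess; set L := _ - (a + b).
have [->|L0] := posnP L; first by [].
apply: (@leq_trans (cnt (fun z => S z && ~~ S (a + z)) b L + cnt (fun z => S z && ~~ S (b + z)) 0 L)).
  rewrite !cnt_sum -big_split /=; apply: leq_sum => i _; rewrite !add0n -addnA.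
  by case: (S i); case: (S (b + i)); case: (S (a + (b + i))).
by apply: leq_add; apply: leq_cnt; rewrite // /L in L0 *; lia.
Qed.

Lemma excess_gen a : S a -> excess a = 0.
Proof.
move=> Sa; rewrite /excess cnt_sum big1 // => i _; rewrite add0n.
by case: (boolP (S i)) => //= Si; rewrite genD.
Qed.

Lemma excess_sum l : all closing l -> excess (sumn l) <= size l * s.
Proof.
elim: l => [|c l IH] /=; first by rewrite excess_gen ?gen0.
move=> /andP [/and4P [_ _ _ cs] /IH ls]; apply: leq_trans (excessD _ _) _.
by rewrite mulSn leq_add.
Qed.

Variable m : nat.
Hypotheses (m0 : 0 < m) (Tm : below m) (minm : forall x, below x -> m <= x).
Hypotheses (nJ : 2 * n <= J * J) (S2n : ~~ S (2 * n)) (Tn : forall x, T x -> x <= n).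

(* Summands can be grouped into multiples of [m], which cost nothing, until fewer than [m]
   of them are left; as they are at least [m], there are at most [sqrt (2 * n)]. *)
Lemma excess_gen_predU q : Q q -> q <= 2 * n -> excess q <= J * s.
Proof.
move=> /genP [l Ql <-] ln.
pose l1 := filter below l; pose l2 := filter (predC below) l.
have E : sumn l = sumn l1 + sumn l2.
  by rewrite -sumn_cat; apply/perm_sumn; rewrite perm_sym perm_filterC.
have [k [l3 [l3m sl3 El3]]] := short_sum l2 m0.
have d3 : all closing l3.
  apply/allP=> x /sl3; rewrite mem_filter => /andP [nx xl].
  by have := allP Ql _ xl; rewrite /= (negbTE nx).
have big : m * size l3 <= sumn l3.
  elim: l3 d3 {l3m sl3 El3} => [|c l3 IH] /=; first by rewrite muln0.
  move=> /andP [/and4P [vc _ _ _] /IH]; rewrite mulnS => IHl; apply: leq_add IHl.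
  by apply: leq_trans vc; case/andP: Tm => _ /ltnW.
have sJ : size l3 <= J.
  rewrite leqNgt; apply/negP=> Js; have := ltn_mul Js Js.
  have := leq_mul (ltnW l3m) (leqnn (size l3)); lia.
rewrite E El3 addnA; apply: leq_trans (excessD _ _) _; rewrite excess_gen ?add0n.
  by apply: leq_trans (excess_sum d3) _; rewrite leq_mul2r sJ orbT.
apply: genD; last by apply: gen_mul; case/andP: Tm.
by apply/genP; exists l1 => //; apply/allP=> x; rewrite mem_filter => /andP [/andP []].
Qed.

Definition hit t a := closing a && Q (2 * n - t - a).

(** For fixed [q] in [Q], a [t] with [2 * n - t - q] closing lies in [S] while [q + t] does not, so
    [excess q] bounds the number of such [t]; summing over [q] counts all hits. *)
Lemma sum_hit : \sum_(t < v | below t) cnt (hit t) 0 n.+1 <= (2 * n).+1 * (J * s).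
Proof.
pose F q t := [&& below t, t + q <= 2 * n, closing (2 * n - t - q) & Q q].
apply: (@leq_trans (\sum_(t < v) \sum_(q < (2 * n).+1) F q t)).
  rewrite big_mkcond /=; apply: leq_sum => t _; case: (boolP (below t)) => // lt.
  have tn : t <= n by case/andP: lt => /Tn.
  apply: (@leq_trans (cnt (hit t) 0 (2 * n - t).+1)); first by apply: leq_cnt; lia.
  rewrite cnt_rev; apply: (@leq_trans (cnt (fun q => F q t) 0 (2 * n - t).+1)).
    rewrite !cnt_sum; apply: leq_sum => q _; rewrite add0n /F /hit lt /=.
    have -> : t + q <= 2 * n by have := ltn_ord q; lia.
    by have -> : 2 * n - t - (2 * n - t - q) = q by have := ltn_ord q; lia.
  apply: (@leq_trans (cnt (fun q => F q t) 0 (2 * n).+1)); first by apply: leq_cnt; lia.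
  by rewrite cnt_sum.
rewrite exchange_big /= -[X in _ <= X * _]card_ord -sum_nat_const; apply: leq_sum => q _.
have [Qq|nQ] := boolP (Q q); last by rewrite big1 // => t _; rewrite /F (negbTE nQ) !andbF.
apply: leq_trans (excess_gen_predU Qq _); last by rewrite -ltnS.
apply: (@leq_trans (cnt (F q) 0 v)); first by rewrite cnt_sum.
rewrite /excess; set w := _ - q.
have Fw x : F q x -> x < w by case/and4P=> _ xq _ _; rewrite /w; lia.
apply: leq_trans (cnt_support v Fw) _; apply: sub_cnt => x /and4P [/andP [Tx _] xq /and4P [_ _ nS _] _].
rewrite gen1 //=; move: nS; congr (~~ S _); lia.
Qed.

Lemma few_hits w B : w <= cnt T 0 v -> (2 * n).+1 * (J * s) <= w * B -> 0 < w ->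
  exists2 t, below t & cnt (hit t) 0 n.+1 <= B.
Proof.
move=> wv wB w0.
have E : \sum_(t < v | below t) 1 = cnt T 0 v.
  rewrite cnt_sum big_mkcond; apply: eq_bigr => i _; rewrite /below ltn_ord andbT add0n.
  by case: (T i).
have [/existsP [t /andP [lt tB]]|/existsPn N] := boolP [exists t : 'I_v, below t && (cnt (hit t) 0 n.+1 <= B)].
  by exists t.
have : \sum_(t < v | below t) B.+1 <= (2 * n).+1 * (J * s).
  apply: leq_trans sum_hit; apply: leq_sum => t lt.
  by have := N t; rewrite lt /= -ltnNge.
have -> : \sum_(t < v | below t) B.+1 = cnt T 0 v * B.+1.
  by rewrite -E big_distrl /=; apply: eq_bigr => i _; rewrite mul1n.
move=> H; have := leq_trans (leq_mul wv (leqnn B.+1)) (leq_trans H wB).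
by rewrite leq_pmul2l // ltnn.
Qed.

Lemma container_bound w B : w <= cnt T 0 v -> (2 * n).+1 * (J * s) <= w * B -> 0 < w ->
  3 * cnt closing 0 n.+1 <= n + 3 * J + 12 + 3 * B.
Proof.
move=> wv wB w0; have [t lt tB] := few_hits wv wB w0.
have := leq_trans m0 (minm lt); case: t lt tB => // t' lt tB _; pose t := t'.+1; rewrite -/t in lt tB.
have Tt : T t by case/andP: lt.
have tn := Tn Tt.
pose D' a := closing a && ~~ Q (2 * n - t - a).
pose G := gen (predU D' (pred1 t)).
have Gt : G t by apply: gen1; rewrite /= eqxx orbT.
have subQ x : predU D' (pred1 t) x -> predU below closing x.
  by case/orP=> [/andP [dx _]|/eqP ->]; rewrite /= ?dx ?lt ?orbT.
(* A representation of [2 * n - t] either uses some [a] from [D'], leaving [2 * n - t - a] in [Q],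
   or consists of copies of [t], making [2 * n] a multiple of [t]. *)
have GF : ~~ G (2 * n - t).
  apply/negP=> /genP [l Gl El].
  have [/hasP [a al /andP [da nQ]]|/hasPn nD] := boolP (has D' l).
    have /perm_sumn Ep := perm_to_rem al; rewrite /= in Ep.
    move/negP: nQ; apply; have -> : 2 * n - t - a = sumn (rem a l) by lia.
    apply/genP; exists (rem a l) => //; apply/allP=> x /mem_rem xl.
    exact: subQ (allP Gl _ xl).
  have El' : l = nseq (size l) t.
    apply/all_pred1P; apply/allP=> x xl /=.
    by have := allP Gl _ xl; rewrite /= (negbTE (nD _ xl)).
  move/negP: S2n; apply; rewrite El' sumn_nseq in El.
  have -> : 2 * n = (size l).+1 * t by lia.
  exact: gen_mul.
have Gmin x : 0 < x < t -> ~~ G x.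
  move=> /andP [x0 xt]; apply/negP=> /genP [[|a l] /=]; first by lia.
  move=> /andP [Ga _] E; have : t <= a.
    case/orP: Ga => [/andP [/andP [va _] _]|/eqP -> //].
    by apply: leq_trans va; case/andP: lt => _ /ltnW.
  lia.
have tJ : t <= J * J by lia.
have := @extremal n t' G (gen0 _) (@genD _) Gt tn GF J tJ Gmin.
have hD : cnt closing 0 n.+1 <= cnt D' 0 n.+1 + cnt (hit t) 0 n.+1.
  rewrite !cnt_sum -big_split /=; apply: leq_sum => i _; rewrite add0n /D' /hit.
  by case: (closing i) => //=; case: (Q _).
have hG : cnt D' 0 n.+1 <= cnt G 0 n.+1 by apply: sub_cnt => x Dx; apply: gen1; rewrite /= Dx.
have : cnt G 0 n.+1 <= cnt G 0 n + 1 by rewrite -[n.+1]addn1 cntD leq_add2l cnt_le.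
lia.
Qed.
End Container.

(** * A container for every avoiding set *)

Section Cover.
Variables (n s w J B : nat).
Hypotheses (s0 : 0 < s) (w0 : 0 < w) (nJ : 2 * n <= J * J).
Hypothesis wB : (2 * n).+1 * (J * s) <= w * B.
Implicit Types A T : {set 'I_n.+1}.

Definition nats_of A (x : nat) := [exists i in A, val i == x].

Lemma nats_of_ord A (i : 'I_n.+1) : nats_of A i = (i \in A).
Proof. by apply/existsP/idP => [[j /andP [jA /eqP /val_inj <-]]|iA] //; exists i; rewrite iA /=. Qed.

Lemma nats_of_le A x : nats_of A x -> x <= n.
Proof. by case/existsP=> i /andP [_ /eqP <-]; rewrite -ltnS; apply: ltn_ord. Qed.

Lemma sub_nats_of A T x : A \subset T -> nats_of A x -> nats_of T x.
Proof. by move=> /subsetP AT /existsP [i /andP [/AT iT ix]]; apply/existsP; exists i; rewrite iT. Qed.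

Lemma card_pred (P : pred nat) : #|[set i : 'I_n.+1 | P i]| = cnt P 0 n.+1.
Proof. by rewrite cnt_card; congr #|pred_of_set _|; apply/setP=> i; rewrite !inE add0n. Qed.

Lemma card_nats_of A : #|A| = cnt (nats_of A) 0 n.+1.
Proof. by rewrite -(card_pred (nats_of A)); congr #|pred_of_set _|; apply/setP=> i; rewrite inE nats_of_ord. Qed.

(* The elements of [T] below [v] stand for the [w] least elements of the covered set. *)
Definition container v T := [set i : 'I_n.+1 | below v (nats_of T) i || closing n s v (nats_of T) i].

Lemma card_container v T : #|container v T| <= cnt (below v (nats_of T)) 0 n.+1 + cnt (closing n s v (nats_of T)) 0 n.+1.
Proof.
rewrite (card_pred (fun x => below v (nats_of T) x || closing n s v (nats_of T) x)) !cnt_sum -big_split /=; apply: leq_sum => i _.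
by case: (below _ _ _); case: (closing _ _ _ _).
Qed.

Lemma container_exists A : ord0 \notin A -> ~~ gen (nats_of A) (2 * n) ->
  exists v T, [/\ v <= n.+1, #|T| <= w + (2 * n).+1 %/ s, A \subset container v T &
    3 * #|container v T| <= n + 3 * (w + J + B + 4)].
Proof.
move=> A0 A2n; have [Aw|wA] := ltnP #|A| w.
  exists n.+1, A; split=> //; first by apply: leq_trans (ltnW Aw) (leq_addr _ _).
    by apply/subsetP=> i iA; rewrite inE /below nats_of_ord iA ltn_ord.
  suff : #|container n.+1 A| <= #|A| by lia.
  apply/subset_leq_card/subsetP=> i; rewrite inE => /orP [/andP []|/and4P [ni]]; first by rewrite nats_of_ord.
  by rewrite leqNgt ni.
rewrite card_nats_of in wA.
have exv : exists v, w <= cnt (nats_of A) 0 v by exists n.+1.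
case: (ex_minnP exv) => v wv minv; have vn : v <= n.+1 by apply: minv.
have vw : cnt (nats_of A) 0 v <= w.
  case: v wv minv {vn} => [|v] wv minv; first by rewrite /cnt.
  rewrite -addn1 cntD; have := cnt_le (nats_of A) (0 + v) 1.
  have : cnt (nats_of A) 0 v < w by rewrite ltnNge; apply/negP=> /minv; rewrite ltnn.
  lia.
pose T0 := [set i in A | i < v].
have cT0 T : T0 \subset T -> w <= cnt (nats_of T) 0 v.
  move=> sT; apply: leq_trans wv _; rewrite !cnt_sum; apply: leq_sum => i _; rewrite add0n.
  case: (boolP (nats_of A i)) => // /existsP [j /andP [jA /eqP ji]].
  by rewrite -ji nats_of_ord (subsetP sT) // inE jA ji ltn_ord.
have cardT0 : #|T0| = w.
  have -> : #|T0| = cnt (nats_of A) 0 v; last by apply/eqP; rewrite eqn_leq vw wv.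
  have -> : T0 = [set i : 'I_n.+1 | below v (nats_of A) i] by apply/setP=> i; rewrite !inE /below nats_of_ord.
  have lv x : below v (nats_of A) x -> x < v by case/andP.
  rewrite (card_pred (below v (nats_of A))); apply/eqP; rewrite eqn_leq (leq_trans (cnt_support _ lv) (sub_cnt _ _ _)).
    have lown x : below v (nats_of A) x -> x < n.+1 by move=> /lv /leq_trans; apply.
    apply: leq_trans (cnt_support v lown); rewrite !cnt_sum; apply: leq_sum => i _.
    by rewrite add0n /below ltn_ord andbT.
  by move=> x /andP [].
(* Each element beyond [T0] must pay for [s] sums up to [2 * n], which bounds [#|T|]; for a largest
   such [T], no [a] in [A] has excess above [s]. *)
pose P T := [&& T0 \subset T, T \subset A & s * (#|T| - w) <= cnt (gen (nats_of T)) 0 (2 * n).+1].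
have PT0 : P T0 by rewrite /P subxx cardT0 subnn muln0 andbT /=; apply/subsetP=> i; rewrite inE => /andP [].
case: (arg_maxnP (fun T => #|T|) PT0) => T /and3P [T0T TA sT] maxT.
have T2n : ~~ gen (nats_of T) (2 * n).
  by apply: contra A2n; apply: sub_gen => x; apply: sub_nats_of.
have Tlow x : below v (nats_of T) x -> 0 < x.
  case/andP=> /existsP [i /andP [iT /eqP <-]] _; rewrite lt0n; apply: contra A0 => i0.
  by rewrite (_ : ord0 = i) ?(subsetP TA) //; apply/val_inj; rewrite /= (eqP i0).
have exm : exists x, below v (nats_of T) x.
  have : 0 < cnt (nats_of T) 0 v by apply: leq_trans (cT0 _ T0T).
  rewrite -has_count => /hasP [x]; rewrite mem_iota => xv Tx; exists x.
  by rewrite /below Tx.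
case: (ex_minnP exm) => m lm minm.
exists v, T; split=> //.
- by rewrite -leq_subLR leq_divRL // mulnC (leq_trans sT) // cnt_le.
- apply/subsetP=> a aA; rewrite inE; apply/orP.
  have [av|va] := ltnP a v; [left|right].
    by rewrite /below nats_of_ord av (subsetP T0T) // inE aA.
  have an : a <= n by rewrite -ltnS.
  have gA x : gen (nats_of T) x -> gen (nats_of A) x by apply: sub_gen => y; apply: sub_nats_of.
  rewrite /closing va an /=; apply/andP; split.
    apply: contra A2n => /gA g; rewrite -(subnKC (leq_trans an (leq_pmull n (isT : 0 < 2)))).
    by rewrite genD // gen1 // nats_of_ord.
  rewrite leqNgt; apply/negP=> ex.
  have aT : a \notin T.
    by apply: contraL ex => aT; rewrite excess_gen // gen1 // nats_of_ord.
  have Pa : P (a |: T).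
    rewrite /P (subset_trans T0T) ?subsetU1 // subUset sub1set aA TA /=.
    rewrite cardsU1 aT add1n subSn; last by rewrite -cardT0 subset_leq_card.
    rewrite mulnS addnC; apply: leq_trans (leq_add sT (ltnW ex)) _.
    set S := gen (nats_of T); set U := gen (nats_of (a |: T)).
    have SU x : S x -> U x by apply: sub_gen => y; apply: sub_nats_of; apply: subsetU1.
    apply: (@leq_trans (cnt S 0 (2 * n).+1 + cnt (fun y => U y && ~~ S y) 0 (2 * n).+1)).
      rewrite leq_add2l /excess -/S.
      apply: (@leq_trans (cnt (fun y => U y && ~~ S y) a ((2 * n).+1 - a))); last by apply: leq_cnt; lia.
      rewrite !cnt_sum; apply: leq_sum => z _; rewrite add0n.
      case: (boolP (S z)) => //= Sz; case: (boolP (S (a + z))) => //= _.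
      suff -> : U (a + z) by [].
      by apply: genD; [apply: gen1; rewrite nats_of_ord setU11 | exact: SU].
    rewrite !cnt_sum -big_split /=; apply: leq_sum => z _; rewrite add0n.
    by case: (boolP (S z)) => [/SU ->|_]; case: (U z).
  have := maxT _ Pa; rewrite cardsU1 aT; lia.
- have := card_container v T; have := @container_bound n s v J (nats_of T) m (Tlow _ lm) lm minm nJ T2n
    (@nats_of_le T) w B (cT0 _ T0T) wB w0.
  have : cnt (below v (nats_of T)) 0 n.+1 <= w.
    apply: leq_trans vw; apply: leq_trans (cnt_support _ (w := v) _) _; first by move=> x /andP [].
    by apply: sub_cnt => x /andP [Tx _]; apply: sub_nats_of Tx.
  lia.
Qed.
End Cover.

(** A set of at most [r] elements is the range of a map from ['I_r] to [option 'I_n.+1], so there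
    are at most [n.+2 ^ r.+1] pairs [(v, T)]; each contributes the subsets of one container. *)
Lemma card_family n (F : nat -> {set 'I_n.+1} -> {set 'I_n.+1}) (Fam : {set {set 'I_n.+1}}) r b :
  (forall A, A \in Fam -> exists v (T : {set 'I_n.+1}), [/\ v <= n.+1, #|T| <= r, A \subset F v T & #|F v T| <= b]) ->
  #|Fam| <= n.+2 ^ r.+1 * 2 ^ b.
Proof.
move=> H.
pose T_of (f : {ffun 'I_r -> option 'I_n.+1}) := [set i | Some i \in codom f].
pose box (p : 'I_n.+2 * {ffun 'I_r -> option 'I_n.+1}) :=
  if #|F p.1 (T_of p.2)| <= b then powerset (F p.1 (T_of p.2)) else set0.
have box_le p : #|box p| <= 2 ^ b.
  by rewrite /box; case: ifP => [le|_]; rewrite ?cards0 // card_powerset leq_pexp2l.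
have sub : Fam \subset \bigcup_p box p.
  apply/subsetP=> A /H [v [T [vn Tr AF Fb]]].
  pose f := [ffun j : 'I_r => if j < #|T| then Some (nth ord0 (enum T) j) else None].
  have Tf : T_of f = T.
    apply/setP=> i; rewrite inE; apply/codomP/idP => [[j]|iT].
      by rewrite ffunE; case: ifP => // jT [->]; rewrite -mem_enum mem_nth // -cardE.
    have ji : index i (enum T) < #|T| by rewrite cardE index_mem mem_enum.
    exists (Ordinal (leq_trans ji Tr)); rewrite ffunE /= ji nth_index ?mem_enum //.
  apply/bigcupP; exists (Ordinal (vn : v < n.+2), f) => //.
  by rewrite /box /= Tf Fb powersetE.
apply: leq_trans (subset_leq_card sub) _.
apply: (@leq_trans (\sum_p #|box p|)).
  elim/big_ind2: _ => // [|X k Y l Xk Yl]; first by rewrite cards0.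
  by rewrite cardsU (leq_trans (leq_subr _ _)) // leq_add.
apply: (@leq_trans (\sum_(p : 'I_n.+2 * {ffun 'I_r -> option 'I_n.+1}) 2 ^ b)).
  by apply: leq_sum => p _; apply: box_le.
by rewrite sum_nat_const card_prod card_ffun card_option !card_ord expnS.
Qed.

Lemma avoiding_family n s w J B (Fam : {set {set 'I_n.+1}}) :
  0 < s -> 0 < w -> 2 * n <= J * J -> (2 * n).+1 * (J * s) <= w * B ->
  (forall A, A \in Fam -> ord0 \notin A /\ ~~ gen (nats_of A) (2 * n)) ->
  #|Fam| <= n.+2 ^ (w + (2 * n).+1 %/ s).+1 * 2 ^ (n %/ 3 + (w + J + B + 4)).
Proof.
move=> s0 w0 nJ wB H; apply: (@card_family n (container s)) => A /H [A0 A2n].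
have [v [T [vn Tr AT cT]]] := container_exists s0 w0 nJ wB A0 A2n.
have aux c m : 3 * c <= n + 3 * m -> c <= n %/ 3 + m by clear; lia.
by exists v, T; split=> //; apply: aux.
Qed.

(** * Choice of parameters *)

Lemma poly_le_exp k : 98 <= k -> k ^ 7 <= 2 ^ (k %/ 2).
Proof.
(* Halving the exponent and taking seventh roots leaves [k <= 2 ^ (k %/ 14)]; [98 = 14 * 7] makes
   [m >= 7], from where on [14 * m.+1 <= 2 ^ m]. *)
move=> k98; pose m := k %/ 14.
have H j : 14 * (j + 7).+1 <= 2 ^ (j + 7).
  by elim: j => // j IH; rewrite addSn expnS; lia.
have km : k <= 2 ^ m.
  have m7 : 7 <= m by rewrite leq_divRL.
  have := H (m - 7); rewrite subnK //.
  by have := ltn_ceil k (isT : 0 < 14); rewrite -/m; lia.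
apply: leq_trans (_ : 2 ^ (m * 7) <= _); first by rewrite expnM leq_exp2r.
rewrite leq_exp2l //; have := leq_trunc_div k 14; rewrite -/m; lia.
Qed.

Lemma upper_exponent n (Fam : {set {set 'I_n.+1}}) : let k := trunc_log 2 n in
  98 <= k ->
  (forall A, A \in Fam -> ord0 \notin A /\ ~~ gen (nats_of A) (2 * n)) ->
  exists2 b, #|Fam| <= 2 ^ (n %/ 3 + b) & k * b <= 100 * n.
Proof.
move=> k k98 H.
have n0 : 0 < n by rewrite lt0n; apply: contraTneq k98 => n0; rewrite /k n0.
have /andP [kn nk] : 2 ^ k <= n < 2 ^ k.+1 by apply: trunc_log_bounds.
(* [J] is about the root of [2 * n]. With [s = k ^ 2] and [w = J * k ^ 4], both [B] and [k] times
   the size of [T] are of order at most [n / k]. *)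
pose J := 2 ^ ((k + 3) %/ 2); pose s := k ^ 2; pose w := J * k ^ 4; pose B := (2 * n).+1 %/ s + 1.
have k0 : 0 < k by lia.
have J0 : 0 < J by rewrite expn_gt0.
have s0 : 0 < s by rewrite expn_gt0 k0.
have w0 : 0 < w by rewrite muln_gt0 J0 expn_gt0 k0.
have nJ : 2 * n <= J * J.
  rewrite -expnD; apply: (@leq_trans (2 ^ k.+2)); first by rewrite expnS leq_mul2l ltnW.
  by rewrite leq_exp2l //; lia.
have sB : (2 * n).+1 <= s * B by rewrite /B addn1 [s * _]mulnC ltnW // ltn_ceil.
have wB : (2 * n).+1 * (J * s) <= w * B.
  have -> : w * B = (s * B) * (J * s) by rewrite /w -[4]/(2 + 2) expnD -/s; lia.
  by rewrite leq_mul2r sB orbT.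
have := avoiding_family s0 w0 nJ wB H; set Q := (2 * n).+1 %/ s => Fle.
exists ((k + 2) * (w + Q).+1 + (w + J + B + 4)).
  apply: leq_trans Fle _; rewrite [n %/ 3 + ((k + 2) * _ + _)]addnCA [2 ^ ((k + 2) * _ + _)]expnD leq_mul2r.
  apply/orP; right.
  rewrite expnM leq_exp2r //; apply: (@leq_trans (2 ^ k.+1).+1) => //.
  have : 0 < 2 ^ k.+1 by rewrite expn_gt0.
  by rewrite addn2 (expnS 2 k.+1); move: (2 ^ k.+1); lia.
have sQ : s * Q <= (2 * n).+1 by rewrite [s * Q]mulnC leq_trunc_div.
have kJ : k ^ 6 * J <= 4 * n.
  apply: (@leq_trans (4 * 2 ^ k)); last by rewrite leq_mul2l kn.
  apply: (@leq_trans (2 ^ (k %/ 2) * (4 * 2 ^ (k %/ 2)))).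
    apply: leq_mul; first by apply: leq_trans (poly_le_exp k98); rewrite leq_pexp2l.
    by rewrite -[4]/(2 ^ 2) -expnD leq_exp2l //; lia.
  rewrite mulnCA -expnD leq_mul2l leq_exp2l //; lia.
have e6 : k ^ 6 = k * k * (k ^ 4) by rewrite -[6]/(2 + 4) expnD.
have e2 : s = k * k by [].
have kw : k * k * w <= 4 * n by rewrite /w (_ : k * k * _ = k ^ 6 * J) // e6; lia.
have kk : k * k <= 4 * n.
  by apply: leq_trans kw; rewrite -{1}[k * k]muln1 leq_mul2l w0 orbT.
have Jw : J <= w by rewrite /w leq_pmulr // expn_gt0 k0.
have kw1 : k * w <= k * k * w by rewrite leq_mul2r leq_pmulr // orbT.
have kJ1 : k * J <= k * w by rewrite leq_mul2l Jw orbT.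
have kQ : k * Q <= s * Q by rewrite leq_mul2r e2 leq_pmulr // orbT.
have k1 : k <= k * k by rewrite leq_pmulr.
rewrite /B -/Q; rewrite e2 in sQ kQ *.
have e : k * ((k + 2) * (w + Q).+1 + (w + J + (Q + 1) + 4)) =
  k * k * w + k * k * Q + k * k + 2 * (k * w) + 2 * (k * Q) + 2 * k + k * w + k * J + k * Q + 5 * k.
  by lia.
rewrite e; lia.
Qed.

(** * The theorem *)

From mathcomp Require Import all_classical all_reals all_analysis lra.
Import Order.TTheory GRing.Theory Num.Theory.
Import numFieldNormedType.Exports.

Lemma gen_allsums n (A : {set 'I_n.+1}) x : gen (nats_of A) x -> allsums (to_nats A) x.
Proof.
move=> /genP [l Al <-]; exists (size l) => //; exists (fun i => nth 0 l i).
  move=> i; have := all_nthP 0 Al i (ltn_ord i).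
  by case/existsP=> j /andP [jA /eqP <-]; exists j.
by rewrite sumnE (big_nth 0) big_mkord.
Qed.

Lemma avoiding_gen n A : A \in avoiding n -> ord0 \notin A /\ ~~ gen (nats_of A) (2 * n).
Proof.
rewrite inE => /andP [A0 /asboolP nA]; split=> //.
by apply/negP=> /gen_allsums.
Qed.

(** At most two summands stay below [2 * n], and three or more exceed it. *)
Lemma upper_third_avoids n (A : {set 'I_n.+1}) :
  (forall i, i \in A -> 2 * n < 3 * i /\ i < n) -> 0 < n -> A \in avoiding n.
Proof.
move=> HA n0; rewrite inE; apply/andP; split.
  by apply/negP=> /HA [] /=; rewrite muln0.
apply/asboolP=> -[k _ [a aA E]].
have {}HA i : 2 * n < 3 * a i /\ a i < n by case: (aA i) => j /= jA <-; apply: HA.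
have [k2|k3] := leqP k 2.
  have : \sum_(i < k) a i <= \sum_(i < k) n.-1 by apply: leq_sum => i _; have [] := HA i; lia.
  by rewrite -E sum_nat_const card_ord; have := leq_mul k2 (leqnn n.-1); lia.
have : \sum_(i < k) (2 * n).+1 <= \sum_(i < k) 3 * a i by apply: leq_sum => i _; have [] := HA i.
by rewrite -big_distrr -E sum_nat_const card_ord /=; have := leq_mul k3 (leqnn (2 * n).+1); lia.
Qed.

Lemma avoiding_lower n : 0 < n -> 2 ^ (n %/ 3).-1 <= #|avoiding n|.
Proof.
move=> n0; pose L := [set i : 'I_n.+1 | (2 * n < 3 * i) && (i < n)]%SET.
have sub : powerset L \subset avoiding n.
  apply/fintype.subsetP=> A; rewrite powersetE => /fintype.subsetP AL; apply: upper_third_avoids => // i /AL.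
  by rewrite inE => /andP [].
apply: leq_trans (subset_leq_card sub); rewrite card_powerset leq_pexp2l //.
rewrite (card_pred n (fun i => (2 * n < 3 * i) && (i < n))).
pose r := (n %/ 3).-1; apply: (@leq_trans (cnt (fun i => (2 * n < 3 * i) && (i < n)) (n - r) r)).
  rewrite cnt_sum -[X in X <= _]card_ord -sum1_card; apply: leq_sum => i _.
  by have := ltn_ord i; rewrite /r; lia.
by apply: leq_cnt; rewrite /r; lia.
Qed.

Local Open Scope classical_set_scope.
Local Open Scope ring_scope.

Lemma avoiding_exponent (R : realType) n : (98 <= trunc_log 2 n)%N ->
  `| (ln #|avoiding n|%:R / ln 2) / n%:R - 1 / 3 | <= 102 / (trunc_log 2 n)%:R :> R.
Proof.
set k := trunc_log 2 n => k98.
have n0 : (0 < n)%N by rewrite lt0n; apply: contraTneq k98 => n0; rewrite /k n0.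
have kn : (k <= n)%N by apply: leq_trans (trunc_logP (isT : (1 < 2)%N) n0); rewrite ltnW // ltn_expl.
have [b up kb] := upper_exponent k98 (@avoiding_gen n).
have low := avoiding_lower n0.
have l2 : 0 < ln 2 :> R by rewrite ln_gt0 // ltr1n.
have N0 : (0 < #|avoiding n|)%N by apply: leq_trans low; rewrite expn_gt0.
set x := ln _ / ln 2.
have lnX m : ln (2 ^ m)%N%:R = m%:R * ln 2 :> R by rewrite natrX lnXn // mulr_natl.
have xu : x <= (n %/ 3 + b)%:R.
  rewrite ler_pdivrMr // -lnX ler_ln ?posrE ?ltr0n ?expn_gt0 // ler_nat //.
have xl : ((n %/ 3).-1)%:R <= x.
  rewrite ler_pdivlMr // -lnX ler_ln ?posrE ?ltr0n ?expn_gt0 // ler_nat //.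
have nR : 0 < n%:R :> R by rewrite ltr0n.
have kR : 0 < k%:R :> R by rewrite ltr0n; lia.
have kb' : k%:R * b%:R <= 100 * n%:R :> R by rewrite -!natrM ler_nat.
have kn' : k%:R <= n%:R :> R by rewrite ler_nat.
have u3 : (n %/ 3)%:R * 3 <= n%:R :> R by rewrite -natrM ler_nat leq_trunc_div.
(* The lower exponent loses at most 2, which with the 100 of the upper one makes 102. *)
have l3 : n%:R <= ((n %/ 3).-1)%:R * 3 + 6 :> R by rewrite -natrM -natrD ler_nat; lia.
rewrite natrD in xu.
have bn : b%:R / n%:R <= 100 / k%:R :> R by rewrite ler_pdivrMr // mulrAC ler_pdivlMr // mulrC.
have nk : 2 / n%:R <= 2 / k%:R :> R by rewrite ler_pM2l // lef_pV2 ?posrE.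
have E1 : x / n%:R - 1 / 3 <= b%:R / n%:R.
  rewrite lerBlDr ler_pdivrMr // mulrDl mulfVK ?gt_eqF //; lra.
have E2 : - (2 / n%:R) <= x / n%:R - 1 / 3.
  rewrite lerBrDr ler_pdivlMr // mulrDl mulNr mulfVK ?gt_eqF //; lra.
have p1 : 0 <= 100 / k%:R :> R by rewrite divr_ge0 // ler0n.
have p2 : 0 <= 2 / k%:R :> R by rewrite divr_ge0 // ler0n.
have -> : 102 / k%:R = 100 / k%:R + 2 / k%:R :> R by rewrite -mulrDl -natrD.
rewrite ler_norml; apply/andP; split; lra.
Qed.

Theorem proposition3p22 (R : realType) :
  exists2 e : nat -> R, e n @[n --> \oo] --> (0 : R) &
    \forall n \near \oo,
      (#|avoiding n|%:R : R) = 2 `^ ((1 / 3 + e n) * n%:R).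
Proof.
(* This [e] solves the required equation exactly for [n >= 1], so only its limit needs the
   estimates. *)
exists (fun n => (ln #|avoiding n|%:R / ln 2) / n%:R - 1 / 3).
  apply/cvgrPdist_le => eps eps0.
  pose K := maxn 98 (Num.trunc (102 / eps)).+1.
  exists (2 ^ K)%N => // n /= Kn.
  have kK : (K <= trunc_log 2 n)%N by apply: trunc_log_max.
  have K98 : (98 <= trunc_log 2 n)%N by apply: leq_trans kK; apply: leq_maxl.
  rewrite sub0r normrN; apply: le_trans (avoiding_exponent R K98) _.
  rewrite ler_pdivrMr; last by rewrite ltr0n; lia.
  rewrite mulrC -ler_pdivrMr //; apply: le_trans (ltW (truncnS_gt _)) _.
  by rewrite ler_nat; apply: leq_trans kK; apply: leq_maxr.
exists 1%N => // n /= n0.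
have N0 : (0 < #|avoiding n|)%N by apply: leq_trans (avoiding_lower n0); rewrite expn_gt0.
rewrite addrC subrK divfK ?pnatr_eq0 -?lt0n //.
have l2 : 0 < ln 2 :> R by rewrite ln_gt0 // ltr1n.
by rewrite /powR pnatr_eq0 /= divfK ?gt_eqF // lnK // posrE ltr0n.
Qed.
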